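(* Let $n\ge 2$, let $\mathcal{H}=\mathcal{H}_1\otimes\cdots\otimes\mathcal{H}_n$ be an analytic Hilbert module over $\mathbb{C}[z_1,\ldots,z_n]$ and let $\mathcal{S}$ be a submodule of $\mathcal{H}$. Then $\mathcal{S}$ is co-doubly commuting if and only if $$\mathcal{S}=(\mathcal{Q}_1\otimes\cdots\otimes\mathcal{Q}_n)^\perp=\sum_{i=1}^n\mathcal{H}_1\otimes\cdots\otimes\mathcal{H}_{i-1}\otimes\mathcal{Q}_i^\perp\otimes\mathcal{H}_{i+1}\otimes\cdots\otimes\mathcal{H}_n$$ for some quotient modules $\mathcal{Q}_i$ of $\mathcal{H}_i$, $i=1,\ldots,n$, where $\mathcal{Q}_i^\perp$ is the orthogonal complement of $\mathcal{Q}_i$ in $\mathcal{H}_i$.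
   Context: Let $\mathbb{D}$ be the open unit disc in $\mathbb{C}$. A reproducing kernel Hilbert module over $\mathbb{C}[z]$ is a Hilbert space $\mathcal{H}$ of holomorphic functions on $\mathbb{D}$ with bounded point evaluations (hence with a reproducing kernel $K$, $f(w)=\langle f,K(\cdot,w)\rangle$), containing the constant function $1$, on which multiplication by the coordinate, $M_z f=zf$, is a bounded operator $\mathcal{H}\to\mathcal{H}$. A closed subspace $\mathcal{S}\subseteq\mathcal{H}$ is a submodule if $M_z\mathcal{S}\subseteq\mathcal{S}$; a closed subspace $\mathcal{Q}$ is a quotient module if $\mathcal{Q}^\perp$ is a submodule. $\mathcal{H}$ is a standard Hilbert module over $\mathbb{C}[z]$ if there do not exist two non-zero quotient modules of $\mathcal{H}$ orthogonal to each other. A standard Hilbert module over $\mathbb{C}[z_1,\ldots,z_n]$ is a Hilbert space tensor product $\mathcal{H}=\mathcal{H}_1\otimes\cdots\otimes\mathcal{H}_n$ of standard Hilbert modules $\mathcal{H}_i$ over $\mathbb{C}[z]$, with module multiplication operators $M_{z_i}=I_{\mathcal{H}_1}\otimes\cdots\otimes M_z\otimes\cdots\otimes I_{\mathcal{H}_n}$ ($M_z$ in the $i$-th place). It is an analytic Hilbert module if moreover, for each $i$, with $K_i$ the kernel of $\mathcal{H}_i$, $K_i^{-1}(z,w)=1/K_i(z,w)$ is a polynomial in $z$ and $\bar w$. A closed subspace $\mathcal{S}\subseteq\mathcal{H}$ is a submodule if $M_{z_i}\mathcal{S}\subseteq\mathcal{S}$ for all $i$; a closed subspace $\mathcal{Q}$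 is a quotient module if $\mathcal{Q}^\perp$ is a submodule. For a quotient module put $C_{z_i}=P_{\mathcal{Q}}M_{z_i}|_{\mathcal{Q}}$, where $P_{\mathcal{Q}}$ is the orthogonal projection onto $\mathcal{Q}$; $\mathcal{Q}$ is doubly commuting if $C_{z_i}C_{z_j}^*=C_{z_j}^*C_{z_i}$ for all $1\le i<j\le n$. A submodule $\mathcal{S}$ is co-doubly commuting if the quotient module $\mathcal{S}^\perp$ is doubly commuting. *)

(* Defs.v *)
From HB Require Import structures.
From mathcomp Require Import all_boot all_order all_algebra polyXY sesquilinear.
From mathcomp Require Import complex.
From mathcomp Require Import all_classical all_reals all_analysis.

Set Implicit Arguments.
Unset Strict Implicit.
Unset Printing Implicit Defensive.

Import Order.TTheory GRing.Theory Num.Theory.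
Import numFieldNormedType.Exports.

Local Open Scope classical_set_scope.
Local Open Scope ring_scope.

(* The inner product is linear in its first argument and conjugate-linear in
   its second one. *)
HB.mixin Record CompleteNormedModule_isHilbert (R : realType) V
    of CompleteNormedModule R[i] V := {
  inner : {dot V for @Num.conj R[i]};
  sqr_norm_inner : forall x : V, `|x| ^+ 2 = inner x x
}.

#[short(type="hilbertType")]
HB.structure Definition Hilbert (R : realType) :=
  {V of CompleteNormedModule R[i] V & CompleteNormedModule_isHilbert R V}.

Notation "''[' x , y ]" := (inner x%R y%R) : ring_scope.

Section HilbertSpaces.
Variables (R : realType).
Implicit Types V W : hilbertType R.

Definition bounded_op V W (f : V -> W) :=
  exists M : R[i], forall x, `|f x| <= M * `|x|.

Definition closed_subspace V (S : set V) :=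
  [/\ closed S, S 0 & forall (a : R[i]) x y, S x -> S y -> S (a *: x + y)].

Definition orth V (S : set V) : set V := [set x | forall y, S y -> '[x, y] = 0].

Definition closed_span V (A : set V) : set V :=
  closure [set x | exists (m : nat) (c : 'I_m -> R[i]) (v : 'I_m -> V),
    (forall k, A (v k)) /\ x = \sum_k c k *: v k].

(* [xget] never falls back to 0 when Q is a closed subspace. *)
Definition proj V (Q : set V) (x : V) : V :=
  xget 0 [set y | Q y /\ orth Q (x - y)].

Definition compression V (Q : set V) (A : V -> V) (x : V) : V := proj Q (A x).

(* Adjoint of a bounded operator A : Q -> Q on the Hilbert space Q; only its
   values on Q are meaningful. *)
Definition adjoint_on V (Q : set V) (A : V -> V) (y : V) : V :=
  xget 0 [set z | Q z /\ forall x, Q x -> '[A x, y] = '[x, z]].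

Definition submodule V (I : Type) (M : I -> V -> V) (S : set V) :=
  closed_subspace S /\ forall i x, S x -> S (M i x).

Definition quotient_module V (I : Type) (M : I -> V -> V) (Q : set V) :=
  closed_subspace Q /\ submodule M (orth Q).

Definition doubly_commuting V n (M : 'I_n -> V -> V) (Q : set V) :=
  forall i j : 'I_n, (i < j)%N -> forall x, Q x ->
    let C k := compression Q (M k) in
    C i (adjoint_on Q (C j) x) = adjoint_on Q (C j) (C i x).

Definition co_doubly_commuting V n (M : 'I_n -> V -> V) (S : set V) :=
  doubly_commuting M (orth S).

End HilbertSpaces.

Definition disc (R : realType) : set R[i] := [set z | `|z| < 1].

(* The elements of a Hilbert module are represented by a Hilbert space together
   with an injective map [fval] to functions; the values of [fval f] outside
   the disc are irrelevant. *)
Record hilbert_module (R : realType) := HilbertModule {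
  hm_space :> hilbertType R;
  fval : hm_space -> R[i] -> R[i];
  fval_linear : forall z, disc z ->
    forall (a : R[i]) f g, fval (a *: f + g) z = a * fval f z + fval g z;
  fval_inj : forall f g,
    (forall z, disc z -> fval f z = fval g z) -> f = g;
  fval_holomorphic : forall f z, disc z ->
    derivable (fval f : R[i]^o -> R[i]^o) z 1;
  fval_bounded : forall z, disc z ->
    exists M : R[i], forall f, `|fval f z| <= M * `|f|;
  hm_has_one : exists e, forall z, disc z -> fval e z = 1;
  Mz : {linear hm_space -> hm_space};
  Mz_bounded : bounded_op Mz;
  MzE : forall f z, disc z -> fval (Mz f) z = z * fval f z
}.

Section HilbertModules.
Variables (R : realType) (H : hilbert_module R).

Definition submodule1 (S : set H) := submodule (fun _ : unit => Mz H) S.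

Definition quotient_module1 (Q : set H) :=
  quotient_module (fun _ : unit => Mz H) Q.

Definition standard_module :=
  ~ exists Q1 Q2 : set H,
    [/\ quotient_module1 Q1, quotient_module1 Q2,
        (exists2 x, Q1 x & x != 0), (exists2 x, Q2 x & x != 0) &
        forall x y, Q1 x -> Q2 y -> '[x, y] = 0].

Definition reproducing_kernel (K : R[i] -> R[i] -> R[i]) :=
  forall w, disc w -> exists k : H,
    (forall z, disc z -> fval k z = K z w) /\
    (forall f, fval f w = '[f, k]).

Definition inverse_kernel_polynomial :=
  exists2 K, reproducing_kernel K &
    exists p : {poly {poly R[i]}}, forall z w, disc z -> disc w ->
      K z w != 0 /\ (K z w)^-1 = p.[z, Num.conj w].

End HilbertModules.

(* Hilbert space tensor products, which are determined up to a unique unitary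
   isomorphism compatible with the elementary tensors. *)
Record hilbert_tensor (R : realType) (n : nat) (H : 'I_n -> hilbertType R) :=
  HilbertTensor {
  ht_space :> hilbertType R;
  tens : (forall i, H i) -> ht_space;
  tens_multilinear : forall (f : forall i, H i) (i : 'I_n) (a : R[i]) x y,
    tens (dfwith f i (a *: x + y)) =
      a *: tens (dfwith f i x) + tens (dfwith f i y);
  inner_tens : forall f g, '[tens f, tens g] = \prod_i '[f i, g i];
  tens_dense : closed_span (range tens) = setT
}.

(* The module operators are the bounded operators I (x) ... (x) M_z (x) ... (x) I,
   which are determined by their values on elementary tensors. *)
Record tensor_module (R : realType) (n : nat) (H : 'I_n -> hilbert_module R) :=
  TensorModule {
  tm_tensor :> hilbert_tensor (fun i => hm_space (H i));
  tMz : 'I_n -> {linear tm_tensor -> tm_tensor};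
  tMz_bounded : forall i, bounded_op (tMz i);
  tMzE : forall i (f : forall j, H j),
    tMz i (tens tm_tensor f) = tens tm_tensor (dfwith f i (Mz (H i) (f i)))
}.

Section TensorModules.
Variables (R : realType) (n : nat) (H : 'I_n -> hilbert_module R).
Variable (T : tensor_module H).

Definition analytic_module :=
  forall i, standard_module (H i) /\ inverse_kernel_polynomial (H i).

Definition tensor_sub (Q : forall i, set (H i)) : set T :=
  closed_span [set tens T f | f in [set f | forall i, Q i (f i)]].

Definition tensor_sub1 (i : 'I_n) (E : set (H i)) : set T :=
  tensor_sub (dfwith (fun j => [set: H j]) i E).

(* The algebraic sum: no closure is taken. *)
Definition sum_sub (F : 'I_n -> set T) : set T :=
  [set x | exists2 y : 'I_n -> T, (forall i, F i (y i)) & x = \sum_i y i].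

End TensorModules.

Arguments tensor_sub {R n H} T Q.
Arguments tensor_sub1 {R n H} T i E.

(* Main.v *)
Require Import Defs.
From HB Require Import structures.
From mathcomp Require Import all_boot all_order all_algebra polyXY sesquilinear.
From mathcomp Require Import complex.
From mathcomp Require Import all_classical all_reals all_analysis.
From mathcomp Require Import ring.

(** Write M for the multiplication by z on one of the modules H_i and M' for its
    adjoint, M_i and M_i' for the corresponding operators on the tensor product,
    and Q for the orthogonal complement of the submodule S.

    A tensor product of quotient modules Q_i is doubly commuting because the
    projection onto it, the M_i and the M_i' all act factor by factor
    (tensor_sub_doubly_commuting). The projections P_i onto
    H_1 (x) ... (x) Q_i (x) ... (x) H_n commute and their product is the projection
    onto the tensor product of the Q_i; expanding 1 - P_n ... P_1 as a telescoping
    sum yields the formula for the orthogonal complement, in particular that the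
    algebraic sum is closed (orth_tensor_sub_sum).

    For the converse, consider first a single module. If p = 1/K, where powers of
    the variable z become powers of M, written on the left, and powers of the
    conjugate of w become powers of M', then p turns into the rank one operator
    u |-> <u, 1> 1. The constant function need not be cyclic for M, but after
    division of p by finitely many linear factors one gets a rank one operator
    u |-> <u, y> x with x and y both cyclic (cyclic_rank_one). The reason is
    that a nonzero complement N of the orbit of y would have an eigenvector of M':
    for z in the disc, p(z, M') N is orthogonal to the kernel function at z, and by
    standardness it has to vanish (noncyclic_root). Multiplying by powers of M on
    the left and of M' on the right produces the operators
    u |-> <u, M^m y> M^l x, in which both kinds of vectors are total.

    Now let Q be doubly commuting and let Q_i be the closed span of its slices in
    the i-th direction. Then Q is contained in the tensor product of the Q_i.
    Double commutativity says that the vectors M_i q - P_Q M_i q, q in Q, form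
    a set invariant under M_j' for j <> i. This set is orthogonal to Q, therefore
    to everything that the rank one operators in the places j <> i make of Q, that
    is, to H_1 (x) ... (x) Q_i (x) ... (x) H_n (compression_defect_orth). Hence the
    compression of M_i to this space preserves Q, and so do the compressions of the
    rank one operators in place i. Composing one of these for every i gives
    u |-> <u, b> a with elementary tensors a and b; as the b are total, Q contains
    the a, which span the tensor product of the Q_i (tensor_sub_factor_sub). *)

Set Implicit Arguments.
Unset Strict Implicit.
Unset Printing Implicit Defensive.

Import Order.TTheory GRing.Theory Num.Theory.
Import numFieldNormedType.Exports.

Local Open Scope classical_set_scope.
Local Open Scope ring_scope.

Local Notation proj := Defs.proj.

(** * The inner product *)

Section InnerProduct.
Variables (R : realType) (V : hilbertType R).
Implicit Types (x y z : V) (a : R[i]) (S : set V).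

Lemma innerDl x y z : '[x + y, z] = '[x, z] + '[y, z].
Proof. exact: linearDl. Qed.

Lemma innerZl a x y : '[a *: x, y] = a * '[x, y].
Proof. exact: linearZl_LR. Qed.

Lemma innerZr a x y : '[x, a *: y] = a^* * '[x, y].
Proof. exact: linearZr_LR. Qed.

Lemma innerBl x y z : '[x - y, z] = '[x, z] - '[y, z].
Proof. exact: linearBl. Qed.

Lemma innerBr x y z : '[x, y - z] = '[x, y] - '[x, z].
Proof. exact: linearBr. Qed.

Lemma inner0l x : '[0, x] = 0.
Proof. exact: linear0l. Qed.

Lemma inner0r x : '[x, 0] = 0.
Proof. exact: linear0r. Qed.

Lemma innerC x y : '[x, y] = ('[y, x])^*.
Proof. by rewrite hermC mul1r. Qed.

Lemma inner_eq0C x y : '[x, y] = 0 -> '[y, x] = 0.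
Proof. by move=> h; rewrite innerC h conjC0. Qed.

Lemma inner_eq0 x : '[x, x] = 0 -> x = 0.
Proof. by move/eqP; rewrite dnorm_eq0 => /eqP. Qed.

Lemma inner_suml I (r : seq I) (P : pred I) (F : I -> V) y :
  '[\sum_(i <- r | P i) F i, y] = \sum_(i <- r | P i) '[F i, y].
Proof. exact: linear_sumlz. Qed.

Lemma inner_sumr I (r : seq I) (P : pred I) (F : I -> V) y :
  '[y, \sum_(i <- r | P i) F i] = \sum_(i <- r | P i) '[y, F i].
Proof. exact: linear_sumr. Qed.

Lemma inner_ext x y : (forall z, '[x, z] = '[y, z]) -> x = y.
Proof.
move=> h; apply/eqP; rewrite -subr_eq0; apply/eqP/inner_eq0.
by rewrite innerBl h subrr.
Qed.

(** Pythagoras for the component of x along y; both the Cauchy-Schwarz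
    inequality and the existence of nearest points come from it. *)
Lemma sub_component_norm x y : y != 0 ->
  let t := '[x, y] / '[y, y] in
  '[x - t *: y, x - t *: y] = '[x, x] - `|'[x, y]| ^+ 2 / '[y, y].
Proof.
move=> y0 t; have ny : '[y, y] != 0 by rewrite dnorm_eq0.
have cy : ('[y, y])^* = '[y, y] by rewrite -innerC.
rewrite innerBl !innerBr !innerZl !innerZr -mulrBr.
have -> : t * ('[y, x] - t^* * '[y, y]) = 0.
  by rewrite /t rmorphM fmorphV /= cy -innerC divfK// subrr mulr0.
by rewrite subr0 /t rmorphM fmorphV /= cy mulrAC -normCKC.
Qed.

Lemma cauchy_schwarz x y : `|'[x, y]| <= `|x| * `|y|.
Proof.
have [->|y0] := eqVneq y 0; first by rewrite inner0r !normr0 mulr0.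
rewrite -(@ler_pXn2r _ 2) ?nnegrE ?mulr_ge0// exprMn !sqr_norm_inner.
have := dnorm_ge0 inner (x - ('[x, y] / '[y, y]) *: y).
by rewrite /= sub_component_norm// subr_ge0 ler_pdivrMr// dnorm_gt0.
Qed.

End InnerProduct.

(** * Closed subspaces and orthogonal projections *)

Section ClosedSubspaces.
Variables (R : realType) (V : hilbertType R).
Implicit Types (x y z : V) (a : R[i]) (S Q : set V).

Lemma closed_approx S x : closed S ->
  (forall e : R[i], 0 < e -> exists2 y, S y & `|x - y| < e) -> S x.
Proof.
move=> cS h; apply: cS => B /nbhs_normP [e /= e0 eB].
by have [y Sy xy] := h _ e0; exists y; split=> //; apply: eB.
Qed.

Lemma approx_closed S :
  (forall x, (forall e : R[i], 0 < e -> exists2 y, S y & `|x - y| < e) -> S x) ->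
  closed S.
Proof.
move=> h x clx; apply: h => e e0.
have [y [Sy xy]] : (S `&` [set y | `|x - y| < e]) !=set0.
  by apply: clx; apply/nbhs_normP; exists e.
by exists y.
Qed.

End ClosedSubspaces.

Section Kernels.
Variables (R : realType) (V : hilbertType R) (W : normedModType R[i]).

(** A bound M for f need not be nonnegative when V is zero; a positive one can
    be divided by. *)
Lemma positive_bound (f : V -> W) (M : R[i]) :
  (forall x, `|f x| <= M * `|x|) ->
  exists2 N : R[i], 0 < N & forall x, `|f x| <= N * `|x|.
Proof.
move=> hM; exists (`|M| + 1) => [|x]; first by rewrite ltr_wpDl.
rewrite (le_trans (hM x))//; have [->|x0] := eqVneq x 0.
  by rewrite normr0 !mulr0.
have nx : 0 < `|x| by rewrite normr_gt0.
have M0 : 0 <= M by rewrite -(pmulr_lge0 _ nx) (le_trans _ (hM x)).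
by rewrite ler_pM2r// ger0_norm// lerDl.
Qed.

Lemma closed_kernel (f : V -> W) (M : R[i]) :
  linear f -> (forall x, `|f x| <= M * `|x|) ->
  closed_subspace [set x | f x = 0].
Proof.
move=> lf /positive_bound[{}M M0 hM].
have f0 : f 0 = 0.
  by have := lf (-1) 0 0; rewrite scaler0 addr0 scaleN1r addNr.
split=> //=; last by move=> a x y fx fy; rewrite lf fx fy scaler0 addr0.
apply: approx_closed => x h; apply/eqP; rewrite -normr_le0.
apply/ler_addgt0Pr => e e0; rewrite add0r.
have [y fy xy] := h (e / M) (divr_gt0 e0 M0).
have -> : f x = f (x - y).
  by rewrite addrC -scaleN1r lf fy scaler0 add0r.
rewrite (le_trans (hM _))//.
by rewrite mulrC -ler_pdivlMr// ltW.
Qed.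

End Kernels.

Section Orthogonality.
Variables (R : realType) (V : hilbertType R).
Implicit Types (x y z : V) (a : R[i]) (S Q : set V).

Lemma closed_subspace0 Q : closed_subspace Q -> Q 0.
Proof. by case. Qed.

Lemma closed_subspaceZ Q a x : closed_subspace Q -> Q x -> Q (a *: x).
Proof. by case=> _ Q0 hQ Qx; rewrite -[_ *: _]addr0; apply: hQ. Qed.

Lemma closed_subspaceD Q x y : closed_subspace Q -> Q x -> Q y -> Q (x + y).
Proof. by case=> _ Q0 hQ Qx Qy; rewrite -[x]scale1r; apply: hQ. Qed.

Lemma closed_subspaceB Q x y : closed_subspace Q -> Q x -> Q y -> Q (x - y).
Proof.
by move=> cQ Qx Qy; rewrite -scaleN1r addrC; case: cQ => _ _; apply.
Qed.

Lemma closed_subspace_sum Q I (r : seq I) (P : pred I) (F : I -> V) :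
  closed_subspace Q -> (forall i, P i -> Q (F i)) ->
  Q (\sum_(i <- r | P i) F i).
Proof.
move=> cQ h; apply: (big_ind Q) => //; first exact: closed_subspace0.
by move=> x y; apply: closed_subspaceD.
Qed.

Lemma closed_subspaceT : closed_subspace [set: V].
Proof. by split=> //; exact: closedT. Qed.

Lemma orth_closed S : closed_subspace (orth S).
Proof.
split; last 2 first.
- by move=> y _; rewrite inner0l.
- by move=> a x y hx hy z Sz; rewrite innerDl innerZl hx// hy// mulr0 addr0.
apply: approx_closed => x h y Sy; apply/eqP; rewrite -normr_le0.
apply/ler_addgt0Pr => e e0; rewrite add0r.
have y1 : 0 < `|y| + 1 by rewrite ltr_wpDl.
have [z hz xz] := h (e / (`|y| + 1)) (divr_gt0 e0 y1).
rewrite -[x](subrK z) innerDl hz// addr0 (le_trans (cauchy_schwarz _ _))//.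
rewrite (@le_trans _ _ (`|x - z| * (`|y| + 1)))//.
  by rewrite ler_wpM2l// lerDl.
by rewrite -ler_pdivlMr ?ltW.
Qed.

(** Choose y such that |x - y|^2 exceeds the infimum over Q by less than e^2. Adding
    t z to y, with t = <x - y, z> / |z|^2, lowers it by |<x - y, z>|^2 / |z|^2, which
    is therefore at most e^2. *)
Lemma almost_orthogonal_approximation Q x (e : R[i]) :
  closed_subspace Q -> 0 < e ->
  exists2 y, Q y & forall z, Q z -> `|'[x - y, z]| <= e * `|z|.
Proof.
move=> cQ e0.
pose N (u : V) : R := complex.Re '[u, u].
have NE u : (N u)%:C%C = '[u, u].
  by rewrite RRe_real// ger0_real// dnorm_ge0.
have N0 u : 0 <= N u by rewrite -ler0c NE dnorm_ge0.
pose D := [set N (x - y) | y in Q].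
have D0 : D !=set0 by exists (N (x - 0)), 0 => //; exact: closed_subspace0.
have lD : has_lbound D by exists 0 => _ [y _ <-].
pose r : R := complex.Re e.
have rE : r%:C%C = e by rewrite RRe_real// ger0_real// ltW.
have r0 : 0 < r by rewrite -ltcR rE.
have [_ [y Qy <-] hy] : exists2 u, D u & u < inf D + r ^+ 2.
  by apply: inf_adherent => //; rewrite exprn_gt0.
exists y => // z Qz.
have [->|z0] := eqVneq z 0; first by rewrite inner0r !normr0 mulr0.
rewrite -(@ler_pXn2r _ 2) ?nnegrE ?mulr_ge0 ?(ltW e0)// exprMn.
set t := '[x - y, z] / '[z, z].
have hN : '[x - (y + t *: z), x - (y + t *: z)] =
    '[x - y, x - y] - `|'[x - y, z]| ^+ 2 / '[z, z].
  by rewrite opprD addrA sub_component_norm.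
have hi : inf D <= N (x - (y + t *: z)).
  apply: ge_inf => //; exists (y + t *: z) => //.
  by apply: closed_subspaceD => //; apply: closed_subspaceZ.
rewrite sqr_norm_inner -ler_pdivrMr ?dnorm_gt0//.
move: hi; rewrite -lecR NE hN lerBrDr => hi.
have := hy; rewrite -ltcR NE rmorphD rmorphXn /= rE => hy'.
by have := ltW (le_lt_trans hi hy'); rewrite lerD2l.
Qed.

(** Two e-approximations y and y' satisfy |y - y'| <= 2 e, because y - y' is
    almost orthogonal to both x - y and x - y'. The approximations therefore form
    a Cauchy filter, whose limit is the projection. *)
Lemma orthogonal_projection_exists Q x :
  closed_subspace Q -> exists y, Q y /\ orth Q (x - y).
Proof.
move=> cQ.
pose A (e : R[i]) :=
  [set y | Q y /\ forall z, Q z -> `|'[x - y, z]| <= e * `|z|].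
have Adiam e y y' : 0 < e -> A e y -> A e y' -> `|y - y'| <= e + e.
  move=> e0 [Qy hy] [Qy' hy'].
  have Qz : Q (y - y') by exact: closed_subspaceB.
  have [->|z0] := eqVneq (y - y') 0.
    by rewrite normr0 addr_ge0 ?ltW.
  rewrite -(@ler_pM2r _ `|y - y'|) ?normr_gt0//.
  rewrite -expr2 sqr_norm_inner -[X in X <= _]ger0_norm ?dnorm_ge0//.
  have E : y - y' = (x - y') - (x - y) by rewrite opprB [RHS]addrC addrA subrK.
  rewrite {1}E innerBl mulrDl.
  rewrite (le_trans (ler_normB _ _))// lerD ?hy ?hy'//.
pose F := filter_from [set e : R[i] | 0 < e] A.
have FF : ProperFilter F.
  apply: filter_from_proper; last first.
    move=> e /= e0; have [y Qy hy] := almost_orthogonal_approximation x cQ e0.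
    by exists y.
  apply: filter_from_filter; first by exists 1 => /=.
  move=> e e' /= e0 e0'.
  have AS r r' : r <= r' -> A r `<=` A r'.
    move=> rr' y [Qy hy]; split=> // z Qz.
    by rewrite (le_trans (hy z Qz))// ler_wpM2r.
  have [ee'|ee'] := real_leP (gtr0_real e0) (gtr0_real e0').
    by exists e => // y Ay; split=> //; apply: AS Ay.
  by exists e' => // y Ay; split=> //; apply: AS Ay; rewrite ltW.
have Fc : cauchy F.
  apply: cauchy_exP => e e0.
  have e2 : 0 < e / 2 / 2 by rewrite !divr_gt0.
  have [y Qy hy] := almost_orthogonal_approximation x cQ e2.
  exists y; exists (e / 2 / 2) => // y' Ay'.
  rewrite -ball_normE /=.
  have /le_lt_trans -> // := Adiam _ _ _ e2 (conj Qy hy) Ay'.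
  by rewrite -splitr ltr_pdivrMr// ltr_pMr// ltr1n.
have /cvg_ex[y Fy] : cvg F by exact: cauchy_cvg.
have Fball e : 0 < e -> F [set y' | `|y - y'| < e].
  by move=> e0; apply: Fy; apply/nbhs_normP; exists e.
exists y; split.
  apply: closed_approx; first by case: cQ.
  move=> e e0; have [r /= r0 hr] := Fball _ e0.
  have [y' Qy' hy'] := almost_orthogonal_approximation x cQ r0.
  by exists y' => //; apply: hr.
move=> z Qz; apply/eqP; rewrite -normr_le0.
apply/ler_addgt0Pr => e e0; rewrite add0r.
have z1 : 0 < `|z| + 1 by rewrite ltr_wpDl.
have e2 : 0 < e / 2 / (`|z| + 1) by rewrite !divr_gt0.
have FA : F (A (e / 2 / (`|z| + 1))) by exists (e / 2 / (`|z| + 1)).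
have FI : F (A (e / 2 / (`|z| + 1)) `&`
             [set y' | `|y - y'| < e / 2 / (`|z| + 1)]).
  by apply: filterI => //; exact: Fball.
have /filter_ex[y' [[Qy' hy'] /= hyy']] := FI.
rewrite -[x](subrK y') -addrA innerDl (le_trans (ler_normD _ _))//.
rewrite [e]splitr lerD//.
  rewrite (le_trans (hy' _ Qz))// -[leLHS]mulrA ger_pMr ?divr_gt0//.
  by rewrite mulrC ler_pdivrMr// mul1r lerDl.
rewrite distrC in hyy'.
rewrite (le_trans (cauchy_schwarz _ _))//.
rewrite (le_trans (ler_wpM2r _ (ltW hyy')))// -[leLHS]mulrA ger_pMr ?divr_gt0//.
by rewrite mulrC ler_pdivrMr// mul1r lerDl.
Qed.

End Orthogonality.

Section Projections.
Variables (R : realType) (V : hilbertType R).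
Implicit Types (x y z : V) (a : R[i]) (S Q : set V).

Lemma proj_spec Q x : closed_subspace Q -> Q (proj Q x) /\ orth Q (x - proj Q x).
Proof.
move=> cQ; have [y hy] := orthogonal_projection_exists x cQ.
by have := xgetPex 0 (ex_intro [set y | Q y /\ orth Q (x - y)] y hy).
Qed.

Lemma proj_in Q x : closed_subspace Q -> Q (proj Q x).
Proof. by move=> /(proj_spec x)[]. Qed.

Lemma proj_orth Q x : closed_subspace Q -> orth Q (x - proj Q x).
Proof. by move=> /(proj_spec x)[]. Qed.

Lemma proj_unique Q x y :
  closed_subspace Q -> Q y -> orth Q (x - y) -> proj Q x = y.
Proof.
move=> cQ Qy hy; apply/eqP; rewrite -subr_eq0; apply/eqP/inner_eq0.
have Qz : Q (proj Q x - y) by apply: closed_subspaceB => //; exact: proj_in.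
have E : proj Q x - y = (x - y) - (x - proj Q x).
  by rewrite opprB [RHS]addrC addrA subrK.
by rewrite {1}E innerBl hy// (proj_orth x cQ)// subrr.
Qed.

Lemma proj_id Q x : closed_subspace Q -> Q x -> proj Q x = x.
Proof. by move=> cQ Qx; apply: proj_unique => // y _; rewrite subrr inner0l. Qed.

Lemma proj_eq0 Q x : closed_subspace Q -> orth Q x -> proj Q x = 0.
Proof.
move=> cQ Qx; apply: proj_unique => //; first exact: closed_subspace0.
by rewrite subr0.
Qed.

Lemma proj_inner Q x y : closed_subspace Q -> Q y -> '[proj Q x, y] = '[x, y].
Proof.
move=> cQ Qy; apply/esym/eqP; rewrite -subr_eq0 -innerBl.
by apply/eqP; apply: proj_orth.
Qed.

Lemma orth_sub S Q : S `<=` Q -> orth Q `<=` orth S.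
Proof. by move=> SQ x hx y /SQ; apply: hx. Qed.

Lemma sub_orth_orth S : S `<=` orth (orth S).
Proof. by move=> x Sx y hy; apply/inner_eq0C/hy. Qed.

Lemma orth_orth Q : closed_subspace Q -> orth (orth Q) = Q.
Proof.
move=> cQ; apply/seteqP; split; last exact: sub_orth_orth.
move=> x hx; rewrite -[x](subrK (proj Q x)).
have hd := proj_orth x cQ.
have -> : x - proj Q x = 0.
  apply: inner_eq0; rewrite innerBl hx// (inner_eq0C (hd _ _)) ?subrr//.
  exact: proj_in.
by rewrite add0r; apply: proj_in.
Qed.

(** This is how density is used: a closed subspace with trivial orthogonal
    complement is everything. *)
Lemma closed_subspace_eqT Q :
  closed_subspace Q -> (forall x, orth Q x -> x = 0) -> forall x, Q x.
Proof.
move=> cQ h x; rewrite -(orth_orth cQ) => y /h ->; exact: inner0r.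
Qed.

Lemma sub_closed_span S : S `<=` closed_span S.
Proof.
move=> x Sx; apply: subset_closure; exists 1, (fun=> 1), (fun=> x); split=> //.
by rewrite big_ord_recl big_ord0 addr0 scale1r.
Qed.

Lemma closed_span_min S Q : closed_subspace Q -> S `<=` Q -> closed_span S `<=` Q.
Proof.
move=> cQ SQ; have [cl _ _] := cQ.
rewrite [X in _ `<=` X](proj1 (closure_id Q) cl); apply: closureS.
move=> _ [m [c [v [hv ->]]]].
by apply: closed_subspace_sum => // k _; apply: closed_subspaceZ => //; exact: SQ.
Qed.

Lemma closed_span_closed S : closed_subspace (closed_span S).
Proof.
split; first exact: closed_closure.
- apply: subset_closure; exists 0, (fun=> 0), (fun=> 0).
  by split=> [[]//|]; rewrite big_ord0.
move=> a x y Sx Sy.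
pose L := [set x | exists (m : nat) (c : 'I_m -> R[i]) (v : 'I_m -> V),
    (forall k, S (v k)) /\ x = \sum_k c k *: v k].
have LP b u v : L u -> L v -> L (b *: u + v).
  move=> [m [c [w [hw ->]]]] [m' [c' [w' [hw' ->]]]].
  exists (m + m')%N.
  exists (fun k => match fintype.split k with inl i => b * c i | inr j => c' j end).
  exists (fun k => match fintype.split k with inl i => w i | inr j => w' j end).
  split=> [k|]; first by case: (fintype.split k).
  rewrite big_split_ord /= scaler_sumr; congr (_ + _); apply: eq_bigr => k _.
    by rewrite (unsplitK (inl k : _ + _)) scalerA.
  by rewrite (unsplitK (inr k : _ + _)).
have approx u : closure L u -> forall e, 0 < e -> exists2 v, L v & `|u - v| < e.
  move=> cu e e0; have [|v [Lv uv]] := cu [set v | `|u - v| < e].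
    by apply/nbhs_normP; exists e.
  by exists v.
rewrite /closed_span -/L => B /nbhs_normP[e /= e0 eB].
have a1 : 0 < `|a| + 1 by rewrite ltr_wpDl.
have [u Lu xu] := approx x Sx _ (divr_gt0 (divr_gt0 e0 (ltr0Sn _ 1)) a1).
have [v Lv yv] := approx y Sy _ (divr_gt0 e0 (ltr0Sn _ 1)).
exists (a *: u + v); split; first exact: LP.
apply: eB => /=; rewrite opprD addrACA -scalerBr (le_lt_trans (ler_normD _ _))//.
rewrite [e]splitr ler_ltD// normrZ.
rewrite ltr_pdivlMr// in xu; apply: le_trans (ltW xu).
by rewrite mulrC ler_wpM2l// lerDl.
Qed.

Lemma orth_closed_span S : orth (closed_span S) = orth S.
Proof.
apply/seteqP; split; first exact/orth_sub/sub_closed_span.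
move=> x hx y Sy; apply/inner_eq0C.
have : orth [set x] y.
  apply: (closed_span_min (orth_closed _) _ Sy) => z Sz _ ->.
  exact/inner_eq0C/hx.
exact.
Qed.

End Projections.

(** * Bounded linear operators and their adjoints *)

(** Operators are plain functions with this property, so that compositions,
    sums, projections and adjoints need no bundled structure. *)
Definition bounded_linear (R : realType) (V W : hilbertType R) (A : V -> W) :=
  linear A /\ bounded_op A.

Section BoundedLinear.
Variables (R : realType).
Implicit Types (V W U : hilbertType R).

Lemma bounded_linearP V W (A : {linear V -> W}) :
  bounded_op A -> bounded_linear A.
Proof. by move=> bA; split=> // a x y; rewrite linearP. Qed.

Section Algebra.
Variables (V W : hilbertType R) (A : V -> W).
Hypothesis bA : bounded_linear A.

Lemma blP a x y : A (a *: x + y) = a *: A x + A y.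
Proof. by case: bA => lA _; apply: lA. Qed.

Lemma blD x y : A (x + y) = A x + A y.
Proof. by rewrite -[x]scale1r blP !scale1r. Qed.

Lemma bl0 : A 0 = 0.
Proof. by apply: (addrI (A 0)); rewrite -blD !addr0. Qed.

Lemma blZ a x : A (a *: x) = a *: A x.
Proof. by rewrite -[a *: x]addr0 blP bl0 addr0. Qed.

Lemma blB x y : A (x - y) = A x - A y.
Proof. by rewrite blD -scaleN1r blZ scaleN1r. Qed.

Lemma bl_sum I (r : seq I) (P : pred I) (F : I -> V) :
  A (\sum_(i <- r | P i) F i) = \sum_(i <- r | P i) A (F i).
Proof. by apply: (big_morph A blD bl0). Qed.

Lemma bl_bound : exists2 M : R[i], 0 < M & forall x, `|A x| <= M * `|x|.
Proof. by case: bA => _ [M /positive_bound]. Qed.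

Lemma bl_kernel_closed : closed_subspace [set x | A x = 0].
Proof. by case: bA => lA [M hM]; apply: (closed_kernel lA hM). Qed.

Lemma bl_preimage_closed (Q : set W) :
  closed_subspace Q -> closed_subspace [set x | Q (A x)].
Proof.
move=> cQ; split=> /=; last 2 first.
- by rewrite bl0; exact: closed_subspace0.
- by move=> a x y Qx Qy; rewrite blP; case: cQ => _ _; apply.
have [M M0 hM] := bl_bound.
apply: approx_closed => x h; apply: (@closed_approx _ _ Q); first by case: cQ.
move=> e e0; have [y Qy xy] := h (e / M) (divr_gt0 e0 M0).
exists (A y) => //; rewrite -blB (le_lt_trans (hM _))//.
by rewrite mulrC -ltr_pdivlMr.
Qed.

End Algebra.

Lemma bl_comp V W U (A : W -> U) (B : V -> W) :
  bounded_linear A -> bounded_linear B -> bounded_linear (A \o B).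
Proof.
move=> bA bB; have [M M0 hM] := bl_bound bA; have [N N0 hN] := bl_bound bB.
split=> [a x y|]; first by rewrite /= !blP.
exists (M * N) => x /=; rewrite (le_trans (hM _))// -mulrA.
by rewrite ler_wpM2l// ltW.
Qed.

Lemma bl_id V : bounded_linear (@id V).
Proof. by split=> //; exists 1 => x; rewrite mul1r. Qed.

Lemma bl_iter V (A : V -> V) k : bounded_linear A -> bounded_linear (iter k A).
Proof.
move=> bA; elim: k => [|k IH]; first exact: bl_id.
by have := bl_comp bA IH.
Qed.

Lemma bl_add V W (A B : V -> W) :
  bounded_linear A -> bounded_linear B -> bounded_linear (fun x => A x + B x).
Proof.
move=> bA bB; have [M M0 hM] := bl_bound bA; have [N N0 hN] := bl_bound bB.
split=> [a x y|]; first by rewrite (blP bA) (blP bB) scalerDr addrACA.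
exists (M + N) => x /=; rewrite (le_trans (ler_normD _ _))// mulrDl.
by rewrite lerD.
Qed.

Lemma bl_scale V W (c : R[i]) (A : V -> W) :
  bounded_linear A -> bounded_linear (fun x => c *: A x).
Proof.
move=> bA; have [M M0 hM] := bl_bound bA.
split=> [a x y|]; first by rewrite (blP bA) scalerDr !scalerA mulrC.
by exists (`|c| * M) => x /=; rewrite normrZ -mulrA ler_wpM2l.
Qed.

Lemma bl_sub V W (A B : V -> W) :
  bounded_linear A -> bounded_linear B -> bounded_linear (fun x => A x - B x).
Proof.
move=> bA bB; have := bl_add bA (bl_scale (-1) bB).
by congr bounded_linear; apply/funext => x; rewrite scaleN1r.
Qed.

Lemma bl_zero V W : bounded_linear (fun=> 0 : W) (V := V).
Proof.
by split=> [a x y|]; [rewrite scaler0 addr0|exists 0 => x; rewrite normr0 mul0r].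
Qed.

Lemma bl_big V W I (r : seq I) (F : I -> V -> W) :
  (forall i, bounded_linear (F i)) ->
  bounded_linear (fun x => \sum_(i <- r) F i x).
Proof.
move=> bF; elim: r => [|i r IH].
  have := bl_zero V W; congr bounded_linear; apply/funext => x.
  by rewrite big_nil.
have := bl_add (bF i) IH; congr bounded_linear; apply/funext => x.
by rewrite big_cons.
Qed.

Lemma bl_rank_one V W (u : V) (v : W) : bounded_linear (fun x => '[x, u] *: v).
Proof.
split=> [a x y|]; first by rewrite innerDl innerZl scalerDl scalerA.
exists (`|u| * `|v|) => x; rewrite normrZ mulrAC ler_wpM2r//.
by rewrite mulrC cauchy_schwarz.
Qed.

Lemma proj_bl V (Q : set V) : closed_subspace Q -> bounded_linear (proj Q).
Proof.
move=> cQ; split=> [a x y|].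
  apply: proj_unique => //; first by case: (cQ) => _ _; apply; exact: proj_in.
  move=> z Qz; rewrite opprD addrACA -scalerBr innerDl innerZl.
  by rewrite !(proj_orth _ cQ)// mulr0 addr0.
exists 1 => x; rewrite mul1r.
have [->|p0] := eqVneq (proj Q x) 0; first by rewrite normr0.
rewrite -(@ler_pM2r _ `|proj Q x|) ?normr_gt0// -expr2 sqr_norm_inner.
rewrite -[leLHS]ger0_norm ?dnorm_ge0// proj_inner//; last exact: proj_in.
exact: cauchy_schwarz.
Qed.

(** If f is not 0, let u be the part of a vector outside the kernel that is
    orthogonal to the kernel. As x - (f x / f u) u lies in the kernel, <x, u> is
    a fixed multiple of f x. *)
Lemma riesz V (f : V -> R[i]) (M : R[i]) :
  (forall a x y, f (a *: x + y) = a * f x + f y) ->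
  (forall x, `|f x| <= M * `|x|) -> exists y, forall x, f x = '[x, y].
Proof.
move=> lf hM.
have cK : closed_subspace [set x | f x = 0].
  by apply: (@closed_kernel _ V R[i]^o f M).
have [f0|/existsNP[x0 /eqP fx0]] := pselect (forall x, f x = 0).
  by exists 0 => x; rewrite f0 inner0r.
set K := [set x | f x = 0] in cK.
have fB x a y : f (x - a *: y) = f x - a * f y.
  by rewrite addrC -scaleNr lf mulNr addrC.
pose u := x0 - proj K x0.
have fu : f u != 0.
  have := proj_in x0 cK; rewrite /K /= => h.
  by rewrite /u -[proj K x0]scale1r fB h mulr0 subr0.
have u0 : '[u, u] != 0.
  rewrite dnorm_eq0; apply: contraNneq fu => ->.
  by rewrite -(subrr 0) -[X in _ - X]scale1r fB mul1r subrr.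
exists (((f u)^* / '[u, u]) *: u) => x.
have Kx : K (x - (f x / f u) *: u) by rewrite /K /= fB divfK// subrr.
have := inner_eq0C (proj_orth x0 cK Kx).
rewrite -/u innerBl innerZl => /eqP; rewrite subr_eq0 => /eqP xu.
rewrite innerZr xu rmorphM fmorphV /= conjCK -innerC.
by field; rewrite fu u0.
Qed.

Definition adj V W (A : V -> W) (y : W) : V :=
  xget 0 [set z | forall x, '[A x, y] = '[x, z]].

Section Adjoint.
Variables (V W : hilbertType R) (A : V -> W).
Hypothesis bA : bounded_linear A.

Lemma adjE x y : '[A x, y] = '[x, adj A y].
Proof.
have [M M0 hM] := bl_bound bA.
have [z hz] : exists z, forall x, '[A x, y] = '[x, z].
  apply: (@riesz _ _ (M * `|y|)) => [a u v|u].
    by rewrite (blP bA) innerDl innerZl.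
  by rewrite (le_trans (cauchy_schwarz _ _))// mulrAC ler_wpM2r.
exact: (xgetPex 0 (ex_intro [set z | forall x, '[A x, y] = '[x, z]] z hz)).
Qed.

Lemma adjEl x y : '[y, A x] = '[adj A y, x].
Proof. by rewrite innerC adjE -innerC. Qed.

Lemma adj_bl : bounded_linear (adj A).
Proof.
split=> [a x y|].
  apply: inner_ext => z.
  by rewrite innerDl innerZl -!adjEl innerDl innerZl.
have [M M0 hM] := bl_bound bA; exists M => y.
have [->|p0] := eqVneq (adj A y) 0; first by rewrite normr0 mulr_ge0// ltW.
rewrite -(@ler_pM2r _ `|adj A y|) ?normr_gt0// -expr2 sqr_norm_inner.
rewrite -[leLHS]ger0_norm ?dnorm_ge0// -adjE.
by rewrite (le_trans (cauchy_schwarz _ _))// mulrAC ler_wpM2r.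
Qed.

End Adjoint.

End BoundedLinear.

(** * Polynomials in an operator and its adjoint *)

Section OperatorPolynomials.
Variables (R : realType) (V : hilbertType R).
Implicit Types (A B : V -> V) (r s : {poly R[i]}) (u v : V) (c : R[i]).

Definition peval A r v : V := \sum_(j < size r) r`_j *: iter j A v.

Lemma peval_wide A r v k :
  (size r <= k)%N -> peval A r v = \sum_(j < k) r`_j *: iter j A v.
Proof.
move=> rk; rewrite /peval (big_ord_widen k (fun j => r`_j *: iter j A v))//.
rewrite big_mkcond; apply: eq_bigr => j _; case: ltnP => // /(nth_default 0) ->.
by rewrite scale0r.
Qed.

Lemma pevalP A c r s v : peval A (c *: r + s) v = c *: peval A r v + peval A s v.
Proof.
pose k := maxn (size (c *: r + s)) (maxn (size r) (size s)).
rewrite !(@peval_wide _ _ _ k) /k ?leq_max ?leqnn ?orbT//.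
rewrite scaler_sumr -big_split; apply: eq_bigr => j _ /=.
by rewrite coefD coefZ scalerDl scalerA.
Qed.

Lemma peval0 A v : peval A 0 v = 0.
Proof. by rewrite /peval size_poly0 big_ord0. Qed.

Lemma peval1 A v : peval A 1 v = v.
Proof. by rewrite /peval size_poly1 big_ord1 coefC scale1r. Qed.

Lemma pevalZ A c r v : peval A (c *: r) v = c *: peval A r v.
Proof. by rewrite -[c *: r]addr0 pevalP peval0 addr0. Qed.

Lemma peval_sum A I (l : seq I) (F : I -> {poly R[i]}) v :
  peval A (\sum_(i <- l) F i) v = \sum_(i <- l) peval A (F i) v.
Proof.
elim: l => [|i l IH]; first by rewrite !big_nil peval0.
by rewrite !big_cons -[F i]scale1r pevalP IH !scale1r.
Qed.

Lemma peval_bl A r : bounded_linear A -> bounded_linear (peval A r).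
Proof. by move=> bA; apply: bl_big => j; apply/bl_scale/bl_iter. Qed.

Lemma peval_commute A B r v : bounded_linear B -> (forall u, A (B u) = B (A u)) ->
  peval A r (B v) = B (peval A r v).
Proof.
move=> bB AB; rewrite /peval bl_sum//; apply: eq_bigr => j _.
rewrite blZ//; congr (_ *: _); elim: (nat_of_ord j) => // k /= ->.
exact: AB.
Qed.

Lemma pevalMX A r v : peval A (r * 'X) v = peval A r (A v).
Proof.
rewrite (@peval_wide _ _ _ (size r).+1); last first.
  by rewrite (leq_trans (size_polyMleq _ _))// size_polyX addn2.
rewrite big_ord_recl coefMX /= scale0r add0r /peval.
by apply: eq_bigr => j _; rewrite coefMX /= -iterSr.
Qed.

Lemma pevalMXsubC A r c v : bounded_linear A ->
  peval A (r * ('X - c%:P)) v = peval A r (A v - c *: v).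
Proof.
move=> bA; rewrite mulrBr mulrC [r * c%:P]mulrC mul_polyC mulrC -scaleN1r.
rewrite addrC pevalP pevalMX pevalZ (blB (peval_bl r bA)) (blZ (peval_bl r bA)).
by rewrite scaleN1r addrC.
Qed.

(** Split r into linear factors and apply them to u one after the other: the
    last nonzero vector obtained is an eigenvector. *)
Lemma peval_eigenvector A (N : set V) r u : bounded_linear A ->
  (forall c v, N v -> N (A v - c *: v)) ->
  r != 0 -> N u -> u != 0 -> peval A r u = 0 ->
  exists c v, [/\ N v, v != 0 & A v = c *: v].
Proof.
move=> bA hN r0 + + /eqP; have [l ->] := closed_field_poly_normal r.
rewrite pevalZ scaler_eq0 lead_coef_eq0 (negPf r0) /=.
elim: l u => [|c l IH] u; first by rewrite big_nil peval1 => _ /negPf ->.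
rewrite big_cons mulrC pevalMXsubC// => Nu u0.
have [/eqP|d0] := eqVneq (A u - c *: u) 0; last by apply: IH => //; exact: hN.
by rewrite subr_eq0 => /eqP Au _; exists c, u.
Qed.

(** The hereditary functional calculus, with B in the role of the adjoint of A: the
    outer variable of p is sent to B, the inner one to A, and all powers of A stand
    to the left of the powers of B. *)
Definition hereditary A B (p : {poly {poly R[i]}}) u : V :=
  \sum_(i < size p) peval A p`_i (iter i B u).

Implicit Types p q : {poly {poly R[i]}}.

Lemma hereditary_wide A B p u m : (size p <= m)%N ->
  hereditary A B p u = \sum_(i < m) peval A p`_i (iter i B u).
Proof.
move=> rk.
rewrite /hereditary (big_ord_widen m (fun i => peval A p`_i (iter i B u)))//.
rewrite big_mkcond; apply: eq_bigr => j _; case: ltnP => // /(nth_default 0) ->.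
by rewrite peval0.
Qed.

Lemma hereditaryE A B p u :
  hereditary A B p u =
  \sum_(i < size p) \sum_(j < sizeY p) p`_i`_j *: iter j A (iter i B u).
Proof.
by apply: eq_bigr => i _; rewrite (@peval_wide _ _ _ (sizeY p)) ?max_size_coefXY.
Qed.

Lemma hereditary_bl A B p : bounded_linear A -> bounded_linear B ->
  bounded_linear (hereditary A B p).
Proof.
move=> bA bB; apply: bl_big => i.
exact: (bl_comp (peval_bl p`_i bA) (bl_iter i bB)).
Qed.

Lemma hereditaryMXsubC A B p c u : bounded_linear A -> bounded_linear B ->
  hereditary A B (p * ('X - (c%:P)%:P)) u = hereditary A B p (B u - c *: u).
Proof.
move=> bA bB; rewrite (@hereditary_wide _ _ _ _ (size p).+1); last first.
  by rewrite (leq_trans (size_polyMleq _ _))// size_XsubC addn2.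
rewrite (blB (hereditary_bl p bA bB)) (blZ (hereditary_bl p bA bB)).
rewrite (@hereditary_wide _ _ p u (size p).+1)//.
have -> : hereditary A B p (B u) = \sum_(i < (size p).+1)
    peval A (p * 'X)`_i (iter i B u).
  rewrite big_ord_recl coefMX /= peval0 add0r; apply: eq_bigr => i _.
  by rewrite coefMX /= -iterSr.
rewrite scaler_sumr -sumrB; apply: eq_bigr => i _.
rewrite mulrBr coefB coefMC [_ * c%:P]mulrC mul_polyC -scaleNr addrC pevalP.
by rewrite addrC scaleNr.
Qed.

Definition adjoint_poly p := swapXY (map_poly (map_poly Num.conj) p).

(** Taking adjoints exchanges the two variables and conjugates the coefficients,
    because (A^j B^i)' = A^i B^j when B = A'. *)
Lemma hereditary_adjoint A p u v : bounded_linear A ->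
  '[hereditary A (adj A) p u, v] = '[u, hereditary A (adj A) (adjoint_poly p) v].
Proof.
move=> bA.
rewrite !hereditaryE /adjoint_poly -sizeYE [sizeY (swapXY _)]sizeYE swapXYK.
set p' := map_poly _ p.
have -> : size p' = size p.
  by rewrite size_map_inj_poly ?map_poly0//; apply: map_poly_inj.
have -> : sizeY p' = sizeY p.
  rewrite /sizeY /p' size_map_inj_poly ?map_poly0//; last exact: map_poly_inj.
  by apply: eq_bigr => i _; rewrite coef_map /= size_map_poly.
rewrite inner_suml; under eq_bigr do rewrite inner_suml.
rewrite exchange_big inner_sumr; apply: eq_bigr => j _.
rewrite inner_sumr; apply: eq_bigr => i _.
rewrite coef_swapXY innerZl innerZr !coef_map /= conjCK; congr (_ * _).
have iterP k a b : '[iter k A a, b] = '[a, iter k (adj A) b].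
  by elim: k a b => // k IH a b; rewrite iterS iterSr adjE// IH.
have iterP' k a b : '[iter k (adj A) a, b] = '[a, iter k A b].
  by rewrite innerC -iterP -innerC.
by rewrite iterP iterP'.
Qed.

End OperatorPolynomials.

Definition total_set (R : realType) (V : hilbertType R) (A : set V) :=
  forall h, (forall a, A a -> '[h, a] = 0) -> h = 0.

Definition orbit_set (R : realType) (V : hilbertType R) (M : V -> V)
    (x : V) : set V :=
  [set iter l M x | l in [set: nat]].

(** * Cyclic vectors of a standard module *)

Section OneVariable.
Variables (R : realType) (H : hilbert_module R).
Let M : H -> H := Mz H.
Let Ms : H -> H := adj M.
Implicit Types (f g u v x y : H) (c z w : R[i]).

Lemma Mz_bl : bounded_linear M.
Proof. exact: bounded_linearP (@Mz_bounded _ H). Qed.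

Lemma Mzs_bl : bounded_linear Ms.
Proof. exact: adj_bl Mz_bl. Qed.

Lemma fval0 z : disc z -> fval (0 : H) z = 0.
Proof.
move=> Dz; have := fval_linear Dz (-1) 0 (0 : H).
by rewrite scaleN1r oppr0 addr0 mulN1r addNr.
Qed.

Lemma fvalZ z c f : disc z -> fval (c *: f) z = c * fval f z.
Proof. by move=> Dz; rewrite -[c *: f]addr0 fval_linear// fval0// addr0. Qed.

Lemma fval_sum z I (r : seq I) (P : pred I) (F : I -> H) : disc z ->
  fval (\sum_(i <- r | P i) F i) z = \sum_(i <- r | P i) fval (F i) z.
Proof.
move=> Dz; apply: (big_morph (fun f => fval f z)) => [f g|]; last exact: fval0.
by rewrite -[f]scale1r fval_linear// mul1r scale1r.
Qed.

Lemma kernel_function z : disc z -> exists k : H, forall f, fval f z = '[f, k].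
Proof.
move=> Dz; have [C hC] := fval_bounded H Dz.
by apply: (@riesz _ _ (fun f => fval f z) C) => // c f g; exact: fval_linear.
Qed.

Lemma fval_peval z (r : {poly R[i]}) f : disc z ->
  fval (peval M r f) z = r.[z] * fval f z.
Proof.
move=> Dz; rewrite /peval fval_sum// horner_coef mulr_suml.
apply: eq_bigr => j _; rewrite fvalZ// -mulrA; congr (_ * _).
elim: (nat_of_ord j) => [|k IH]; first by rewrite mul1r.
by rewrite iterS MzE// IH exprS mulrA.
Qed.

(** The vector k that represents the evaluation at z is an eigenvector of the
    adjoint: <f, M' k> = <M f, k> = z f(z). *)
Lemma Mzs_kernel z k : (forall f, fval f z = '[f, k]) -> disc z ->
  Ms k = z^* *: k.
Proof.
move=> hk Dz; apply: inner_ext => f.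
rewrite -(adjEl Mz_bl) innerC -hk MzE// hk rmorphM /= -innerC.
by rewrite innerZl.
Qed.

(** The points 1/2, 1/3, ... of the disc are more than the roots of r. *)
Lemma poly_nonzero_in_disc (r : {poly R[i]}) : r != 0 -> exists2 z, disc z & r.[z] != 0.
Proof.
move=> r0; pose s := [seq (k.+2%:R : R[i])^-1 | k <- iota 0 (size r)].
have us : uniq s.
  rewrite map_inj_uniq ?iota_uniq// => i j /invr_inj/eqP.
  by rewrite eqr_nat => /eqP[].
have /allPn[z zs rz] : ~~ all (root r) s.
  apply/negP => h; have := max_poly_roots r0 h us.
  by rewrite size_map size_iota ltnn.
exists z => //; move: zs => /mapP[k _ ->]; rewrite /disc /=.
by rewrite normfV normr_nat invf_lt1 ?ltr0n// ltr1n.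
Qed.

Lemma fval_continuous f z : disc z ->
  forall e : R[i], 0 < e -> exists2 d : R[i], 0 < d &
    forall w, `|z - w| < d -> `|fval f z - fval f w| < e.
Proof.
move=> Dz e e0.
have /derivable1_diffP/differentiable_continuous cf :=
  @fval_holomorphic _ H f z Dz.
have /cvgrPdist_lt/(_ e e0) := cf.
by move=> /nbhs_normP[d /= d0 hd]; exists d => // w /hd.
Qed.

(** From (z - c) f(z) = 0 on the disc, f vanishes off c, and at c by continuity. *)
Lemma Mz_no_eigenvector c f : M f = c *: f -> f = 0.
Proof.
move=> Mf; have f0 z : disc z -> z != c -> fval f z = 0.
  move=> Dz zc; have : (z - c) * fval f z = 0.
    by rewrite mulrBl -MzE// -/M Mf fvalZ// subrr.
  by move/eqP; rewrite mulf_eq0 subr_eq0 (negPf zc) => /eqP.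
apply: fval_inj => z Dz; rewrite fval0//.
have [zc|/(f0 z Dz)//] := eqVneq z c.
apply/eqP; apply: contraT => fz.
have fz0 : 0 < `|fval f z| by rewrite normr_gt0.
have [d d0 hd] := fval_continuous f Dz fz0.
have z1 : 0 < 1 - `|z| by rewrite subr_gt0.
have [t t0 [td t1]] : exists2 t : R[i], 0 < t & t < d /\ t < 1 - `|z|.
  have [dz|dz] := real_leP (gtr0_real d0) (gtr0_real z1).
    exists (d / 2); first by rewrite divr_gt0.
    have h : d / 2 < d by rewrite ltr_pdivrMr// ltr_pMr// ltr1n.
    by split=> //; apply: lt_le_trans dz.
  exists ((1 - `|z|) / 2); first by rewrite divr_gt0.
  have h : (1 - `|z|) / 2 < 1 - `|z| by rewrite ltr_pdivrMr// ltr_pMr// ltr1n.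
  by split=> //; apply: lt_trans dz.
have := hd (z + t); rewrite opprD addNKr normrN gtr0_norm// => /(_ td).
rewrite (f0 (z + t)) ?subr0 ?ltxx//.
  rewrite /disc /= (le_lt_trans (ler_normD _ _))// (gtr0_norm t0).
  by rewrite -ltrBrDl.
by rewrite -zc -subr_eq0 addrAC subrr add0r gt_eqF.
Qed.

Lemma peval_inj (r : {poly R[i]}) f : r != 0 -> peval M r f = 0 -> f = 0.
Proof.
move=> r0 rf; apply/eqP; apply: contraT => f0.
have [c [v [_ v0 /Mz_no_eigenvector vE]]] :=
  @peval_eigenvector _ _ M setT r f Mz_bl (fun _ _ _ => I) r0 I f0 rf.
by rewrite vE eqxx in v0.
Qed.

(** Sets invariant under the adjoint of M span quotient modules, so standardness
    already forbids that two such sets be orthogonal unless one is zero. *)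
Lemma standard_not_orthogonal (S1 S2 : set H) u1 u2 : standard_module H ->
  (forall u, S1 u -> S1 (Ms u)) -> (forall u, S2 u -> S2 (Ms u)) ->
  (forall x y, S1 x -> S2 y -> '[x, y] = 0) ->
  S1 u1 -> S2 u2 -> u2 != 0 -> u1 = 0.
Proof.
move=> st M1 M2 h Su1 Su2 u20; apply/eqP; apply: contraT => u10.
exfalso; apply: st; exists (closed_span S1), (closed_span S2).
have qm (S : set H) : (forall u, S u -> S (Ms u)) ->
    quotient_module1 (closed_span S).
  move=> MS; split; first exact: closed_span_closed.
  rewrite orth_closed_span; split; first exact: orth_closed.
  by move=> _ x hx y Sy; rewrite adjE ?hx//; [exact: MS|exact: Mz_bl].
split; [exact: qm|exact: qm|exists u1|exists u2|] => //.
- exact: sub_closed_span.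
- exact: sub_closed_span.
move=> x y cx; have : orth S2 x.
  apply: (closed_span_min (orth_closed _) _ cx) => z Sz w Sw; exact: h.
by rewrite -orth_closed_span => hx /hx.
Qed.

Lemma rank_one_nonzero p x y : x != 0 -> y != 0 ->
  (forall u, hereditary M Ms p u = '[u, y] *: x) -> p != 0.
Proof.
move=> x0 y0 hp; apply/eqP => p0; have := hp y.
rewrite p0 /hereditary size_poly0 big_ord0 => /esym/eqP.
by rewrite scaler_eq0 (negPf x0) dnorm_eq0 (negPf y0).
Qed.

(** Let N, the complement of the orbit of y, be nonzero; p(M, M') vanishes on N.
    For a point z of the disc with r = p(z, .) nonzero, this says that r(M') N is
    orthogonal to the kernel function at z. Both generate quotient modules, so
    r(M') N = 0 by standardness, and M' has an eigenvector in N. If c is its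
    eigenvalue, then p(M, c) kills it; as M has no eigenvector, p(., c) = 0. *)
Lemma noncyclic_root p x y : standard_module H -> x != 0 -> y != 0 ->
  (forall u, hereditary M Ms p u = '[u, y] *: x) ->
  ~ total_set (orbit_set M y) -> exists c, root p c%:P.
Proof.
move=> st x0 y0 hp.
move=> /existsNP[u0 /not_implyP[Nu0 /eqP u00]].
pose N := [set u : H | forall l, '[u, iter l M y] = 0].
have hN u : N u -> hereditary M Ms p u = 0.
  by move=> Nu; rewrite hp (Nu 0) scale0r.
have NM u : N u -> N (Ms u).
  by move=> Nu l; rewrite -(adjEl Mz_bl) -iterS.
have NL c u v : N u -> N v -> N (v - c *: u).
  by move=> Nu Nv l; rewrite innerBl innerZl Nu Nv mulr0 subrr.
have Nu0' : N u0 by move=> l; apply: Nu0; exists l.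
have p0 := rank_one_nonzero x0 y0 hp.
have [z0 Dz0 r0] : exists2 z0, disc z0 & map_poly (horner_eval z0) p != 0.
  have : lead_coef p != 0 by rewrite lead_coef_eq0.
  move=> /poly_nonzero_in_disc[z Dz hz]; exists z => //.
  apply/eqP => /polyP/(_ (size p).-1).
  by rewrite coef_map coef0 /= /horner_eval => /eqP; apply/negP.
set r := map_poly _ p in r0.
have [k hk] := kernel_function Dz0.
have k0 : k != 0.
  have [e he] := hm_has_one H; apply/eqP => k0.
  by have := he _ Dz0; rewrite hk k0 inner0r => /esym/eqP; rewrite oner_eq0.
have rN u : N u -> '[peval Ms r u, k] = 0.
  move=> Nu; rewrite -hk (@peval_wide _ _ _ _ _ (size p)); last exact: size_poly.
  transitivity (fval (hereditary M Ms p u) z0); last by rewrite hN// fval0.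
  rewrite /hereditary !fval_sum//; apply: eq_bigr => i _.
  by rewrite fvalZ// fval_peval// coef_map.
have ru0 : peval Ms r u0 = 0.
  apply: (@standard_not_orthogonal [set peval Ms r u | u in N]
            [set c *: k | c in [set: R[i]]] _ k st) => //.
  - move=> _ [u Nu <-]; exists (Ms u); first exact: NM.
    by apply: peval_commute => //; exact: Mzs_bl.
  - move=> _ [c _ <-]; exists (c * z0^*) => //.
    by rewrite (blZ Mzs_bl) (Mzs_kernel hk)// scalerA.
  - by move=> _ _ [u Nu <-] [c _ <-]; rewrite innerZr rN// mulr0.
  - by exists u0.
  - by exists 1 => //; rewrite scale1r.
have [|c [v [Nv v0 hv]]] := peval_eigenvector Mzs_bl _ r0 Nu0' u00 ru0.
  by move=> c v Nv; apply: NL => //; exact: NM.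
exists c; apply/rootP; apply/eqP; apply: contraT => pc.
suff : peval M p.[c%:P] v = 0 by move/(peval_inj pc)/eqP; rewrite (negPf v0).
transitivity (hereditary M Ms p v); last exact: hN.
rewrite /hereditary horner_coef peval_sum; apply: eq_bigr => i _.
have -> : iter i Ms v = c ^+ i *: v.
  elim: (nat_of_ord i) => [|j IH]; first by rewrite scale1r.
  by rewrite iterS IH (blZ Mzs_bl) hv scalerA exprSr.
by rewrite (blZ (peval_bl _ Mz_bl)) -pevalZ -polyC_exp mulrC mul_polyC.
Qed.

(** If p(M, M') (M' - c) has rank one with range in the line of x, so has
    p(M, M'), because the range of M' - c is dense: M has no eigenvector. *)
Lemma divide_root p c x y : x != 0 ->
  (forall u, hereditary M Ms (p * ('X - (c%:P)%:P)) u = '[u, y] *: x) ->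
  exists y', forall u, hereditary M Ms p u = '[u, y'] *: x.
Proof.
move=> x0 hp; pose h := hereditary M Ms p.
have bh : bounded_linear h := hereditary_bl p Mz_bl Mzs_bl.
have hD u : h (Ms u - c *: u) = '[u, y] *: x.
  by rewrite /h -(hereditaryMXsubC p c u Mz_bl Mzs_bl).
have nx : '[x, x] != 0 by rewrite dnorm_eq0.
have hx v (w : H) : '[v, x] = 0 -> '[h w, v] = 0.
  move=> vx; rewrite adjE//; set a := adj h v.
  have ha u : '[Ms u - c *: u, a] = 0.
    by rewrite /a -adjE// hD innerZl (inner_eq0C vx) mulr0.
  have : a = 0.
    apply: (@Mz_no_eigenvector (c^*)); apply: inner_ext => u.
    rewrite (adjE Mz_bl) innerZl; have := inner_eq0C (ha u).
    by rewrite innerBr innerZr => /eqP; rewrite subr_eq0 => /eqP.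
  by move=> ->; rewrite inner0r.
exists ('[x, x]^-1 *: adj h x) => u; rewrite -/h.
rewrite innerZr fmorphV /= -innerC -adjE//.
apply/eqP; rewrite -subr_eq0; apply/eqP/inner_eq0.
set d := h u - _; have dx : '[d, x] = 0.
  by rewrite /d innerBl innerZl mulrC mulrA divff// mul1r subrr.
by rewrite {1}/d innerBl innerZl hx// (inner_eq0C dx) mulr0 subrr.
Qed.

(** Dividing out a root lowers the degree of p, so this can happen only finitely
    often. Only y changes, hence a second run on the adjoint polynomial will take
    care of x without spoiling y. *)
Lemma cyclic_right_factor p x y : standard_module H -> x != 0 -> y != 0 ->
  (forall u, hereditary M Ms p u = '[u, y] *: x) ->
  exists q y', (forall u, hereditary M Ms q u = '[u, y'] *: x) /\
    total_set (orbit_set M y').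
Proof.
move=> st x0; have [n] := ubnP (size p).
elim: n p y => // n IH p y sp y0 hp.
have [?|nt] := pselect (total_set (orbit_set M y)); first by exists p, y.
have [c /factor_theorem[q pq]] := noncyclic_root st x0 y0 hp nt.
have p0 := rank_one_nonzero x0 y0 hp.
have [y' hq] : exists y', forall u, hereditary M Ms q u = '[u, y'] *: x.
  by apply: (@divide_root q c x y x0) => u; rewrite -pq.
apply: (IH q y') => //.
  have q0 : q != 0 by apply: contraNneq p0 => q0; rewrite pq q0 mul0r.
  by move: sp; rewrite pq size_Mmonic ?monicXsubC// size_XsubC addn2.
apply/eqP => y'0; have := hp y; rewrite pq hereditaryMXsubC ?hq ?y'0.
- rewrite inner0r scale0r => /esym/eqP.
  by rewrite scaler_eq0 (negPf x0) dnorm_eq0 (negPf y0).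
- exact: Mz_bl.
- exact: Mzs_bl.
Qed.

Lemma total_nonzero y x : total_set (orbit_set M y) -> x != 0 -> y != 0.
Proof.
move=> ty; apply: contraNneq => y0; apply/eqP/ty => _ [l _ <-].
by rewrite y0 (bl0 (bl_iter l Mz_bl)) inner0r.
Qed.

(** With p = 1/K, the operator p(M, M') is the rank one operator u |-> <u, 1> 1:
    on a kernel function K(., w), where M' acts as the conjugate of w, its value is
    p(z, w) K(z, w) = 1. The constant 1 may fail to be cyclic, for instance when
    the functions of the module extend to a larger disc and have been divided by
    z - a for some a of that disc outside the unit disc; such linear factors of p
    are divided out. *)
Lemma cyclic_rank_one : standard_module H -> inverse_kernel_polynomial H ->
  exists p x y, [/\ forall u, hereditary M Ms p u = '[u, y] *: x,
    total_set (orbit_set M x) & total_set (orbit_set M y)].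
Proof.
move=> st [K hK [p hp]].
have [e he] := hm_has_one H.
have D0 : disc (0 : R[i]) by rewrite /disc /= normr0.
have e0 : e != 0.
  by apply/eqP => e0; have /esym/eqP := he _ D0; rewrite e0 fval0// oner_eq0.
pose p0 := swapXY p.
have bp0 := hereditary_bl p0 Mz_bl Mzs_bl.
have hp0 u : hereditary M Ms p0 u = '[u, e] *: e.
  have bd := bl_sub bp0 (bl_rank_one e e).
  apply/eqP; rewrite -subr_eq0; apply/eqP.
  apply: (closed_subspace_eqT (bl_kernel_closed bd)) => {}u hu.
  apply: fval_inj => w Dw; rewrite fval0//.
  have [k [kK hk]] := hK w Dw; rewrite hk; apply: hu => /=.
  apply/eqP; rewrite subr_eq0; apply/eqP/fval_inj => z Dz.
  rewrite innerC -hk he// conjC1 scale1r he// /hereditary fval_sum//.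
  have [Kn KV] := hp z w Dz Dw.
  rewrite -(mulVf Kn) KV -horner2_swapXY (horner_coef (swapXY p)).
  rewrite horner_sum mulr_suml; apply: eq_bigr => i _; rewrite fval_peval// hornerM -mulrA; congr (_ * _).
  have -> : iter i Ms k = (w^*) ^+ i *: k.
    elim: (nat_of_ord i) => [|j IH]; first by rewrite scale1r.
    by rewrite iterS IH (blZ Mzs_bl) (Mzs_kernel hk)// scalerA exprSr.
  by rewrite fvalZ// kK// -polyC_exp hornerC.
have [p1 [y [hp1 ty]]] := cyclic_right_factor st e0 e0 hp0.
have y0 := total_nonzero ty e0.
have hp1' u : hereditary M Ms (adjoint_poly p1) u = '[u, e] *: y.
  apply: inner_ext => v; apply: (can_inj conjCK); rewrite -!innerC.
  rewrite -(hereditary_adjoint _ _ _ Mz_bl) hp1 innerZl innerZr.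
  by rewrite mulrC -innerC.
have [p2 [x [hp2 tx]]] := cyclic_right_factor st y0 e0 hp1'.
by exists p2, y, x.
Qed.

End OneVariable.

(** * Operators acting on one factor of a tensor product *)

Section Tensors.
Variables (R : realType) (n : nat) (H : 'I_n -> hilbertType R).
Variable (T : hilbert_tensor H).
Implicit Types (f g : forall i, H i) (i j : 'I_n).

Lemma dfwith_id f i : dfwith f i (f i) = f.
Proof.
apply: functional_extensionality_dep => j.
by have [<-|ij] := eqVneq i j; rewrite ?dfwithin// dfwithout.
Qed.

Lemma dfwithK f i (a b : H i) : dfwith (dfwith f i a) i b = dfwith f i b.
Proof.
apply: functional_extensionality_dep => j.
by have [<-|ij] := eqVneq i j; rewrite ?dfwithin// !dfwithout.
Qed.

Lemma dfwithC f i j (a : H i) (b : H j) : i != j ->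
  dfwith (dfwith f i a) j b = dfwith (dfwith f j b) i a.
Proof.
move=> ij; apply: functional_extensionality_dep => k.
have [<-|ik] := eqVneq i k.
  by rewrite dfwithin dfwithout 1?eq_sym// dfwithin.
rewrite [RHS]dfwithout//; have [<-|jk] := eqVneq j k; first by rewrite !dfwithin.
by rewrite !dfwithout.
Qed.

Lemma inner_tens_dfwith f g i (h h' : H i) :
  '[tens T (dfwith f i h), tens T (dfwith g i h')] =
  '[h, h'] * \prod_(j | j != i) '[f j, g j].
Proof.
rewrite inner_tens (bigD1 i)//= !dfwithin; congr (_ * _).
by apply: eq_bigr => j ji; rewrite !dfwithout// eq_sym.
Qed.

Lemma tens_coordinate_bl f i : bounded_linear (fun h => tens T (dfwith f i h)).
Proof.
split=> [a x y|]; first exact: tens_multilinear.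
exists (sqrtC (\prod_(j | j != i) '[f j, f j])) => h.
have P0 : 0 <= \prod_(j | j != i) '[f j, f j].
  by apply: prodr_ge0 => j _; exact: dnorm_ge0.
rewrite -(@ler_pXn2r _ 2) ?nnegrE ?mulr_ge0 ?sqrtC_ge0// exprMn sqrtCK.
by rewrite !sqr_norm_inner inner_tens_dfwith mulrC.
Qed.

Lemma tens_spans (X : set T) : closed_subspace X ->
  (forall f, X (tens T f)) -> forall u, X u.
Proof.
move=> cX hX u; have : closed_span (range (tens T)) u by rewrite tens_dense.
by apply: closed_span_min => // _ [f _ <-].
Qed.

Lemma tens_inner_ext (u v : T) :
  (forall f, '[u, tens T f] = '[v, tens T f]) -> u = v.
Proof.
move=> h; apply/eqP; rewrite -subr_eq0; apply/eqP/inner_eq0.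
have := @tens_spans (orth [set u - v]) (orth_closed _).
move=> /(_ _ (u - v)) -> // f _ ->; apply: inner_eq0C.
by rewrite innerBl h subrr.
Qed.

Lemma tens_map_ext (W : hilbertType R) (A B : T -> W) :
  bounded_linear A -> bounded_linear B ->
  (forall f, A (tens T f) = B (tens T f)) -> forall u, A u = B u.
Proof.
move=> bA bB AB u; apply/eqP; rewrite -subr_eq0; apply/eqP.
apply: (tens_spans (bl_kernel_closed (bl_sub bA bB))) => f /=.
by rewrite AB subrr.
Qed.

(** The coordinates are moved from A i to its closed span one at a time: the
    elementary tensor is a bounded linear function of each of them. *)
Lemma tens_closed_span (A : forall i, set (H i)) (X : set T) :
  closed_subspace X ->
  (forall f, (forall i, A i (f i)) -> X (tens T f)) ->
  forall f, (forall i, closed_span (A i) (f i)) -> X (tens T f).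
Proof.
move=> cX hX.
suff h k f : (forall i, (i < k)%N -> closed_span (A i) (f i)) ->
    (forall i, (k <= i)%N -> A i (f i)) -> X (tens T f).
  by move=> f hf; apply: (h n) => i; rewrite // leqNgt ltn_ord.
elim: k f => [|k IH] f h1 h2; first by apply: hX => i; exact: h2.
have [kn|nk] := ltnP k n; last first.
  apply: IH => i ik; first by apply: h1; exact: ltnW.
  by have := ltn_ord i; rewrite ltnNge (leq_trans nk).
pose i0 := Ordinal kn.
have bc := tens_coordinate_bl f i0.
rewrite -[f](dfwith_id _ i0).
have cp := bl_preimage_closed bc cX.
apply: (closed_span_min cp _ (h1 i0 (ltnSn k))) => a Aa /=.
apply: IH => i ik.
  have ne : i0 != i by apply: contraTneq ik => <-; rewrite /= ltnn.
  by rewrite dfwithout//; apply/h1/ltnW.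
have [<-|ne] := eqVneq i0 i; first by rewrite dfwithin.
by rewrite dfwithout//; apply: h2; rewrite ltn_neqAle ik andbT; exact: ne.
Qed.

(** B is I (x) ... (x) A (x) ... (x) I with A in place i; a bounded linear B is
    determined by these values. *)
Definition acts_on i (A : H i -> H i) (B : T -> T) :=
  forall f, B (tens T f) = tens T (dfwith f i (A (f i))).

Lemma acts_on_id i : acts_on (@id (H i)) id.
Proof. by move=> f; rewrite dfwith_id. Qed.

Lemma acts_on_comp i (A A' : H i -> H i) B B' :
  acts_on A B -> acts_on A' B' -> acts_on (A \o A') (B \o B').
Proof. by move=> h h' f; rewrite /= h' h dfwithin dfwithK. Qed.

Lemma acts_on_iter i (A : H i -> H i) B k :
  acts_on A B -> acts_on (iter k A) (iter k B).
Proof.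
move=> h; elim: k => [|k IH]; first exact: acts_on_id.
by have := acts_on_comp h IH.
Qed.

Lemma acts_on_scale i (A : H i -> H i) B c :
  acts_on A B -> acts_on (fun x => c *: A x) (fun u => c *: B u).
Proof. by move=> h f; rewrite h (blZ (tens_coordinate_bl f i)). Qed.

Lemma acts_on_sum i I (r : seq I) (A : I -> H i -> H i) (B : I -> T -> T) :
  (forall k, acts_on (A k) (B k)) ->
  acts_on (fun x => \sum_(k <- r) A k x) (fun u => \sum_(k <- r) B k u).
Proof.
move=> h f; rewrite (bl_sum (tens_coordinate_bl f i)).
by apply: eq_bigr => k _; rewrite h.
Qed.

Lemma acts_on_peval i (A : H i -> H i) B r :
  acts_on A B -> acts_on (peval A r) (peval B r).
Proof. by move=> h; apply: acts_on_sum => k; apply/acts_on_scale/acts_on_iter. Qed.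

Lemma acts_on_hereditary i (A A' : H i -> H i) B B' p :
  acts_on A B -> acts_on A' B' -> acts_on (hereditary A A' p) (hereditary B B' p).
Proof.
move=> h h'; apply: acts_on_sum => k.
by have := acts_on_comp (acts_on_peval p`_k h) (acts_on_iter k h').
Qed.

Lemma acts_on_commute i j (A : H i -> H i) (A' : H j -> H j) B B' : i != j ->
  bounded_linear B -> bounded_linear B' -> acts_on A B -> acts_on A' B' ->
  forall u, B (B' u) = B' (B u).
Proof.
move=> ij bB bB' h h'.
apply: (tens_map_ext (bl_comp bB bB') (bl_comp bB' bB)) => f /=.
rewrite h' !h h' (dfwithout _ _ ij) (dfwithout f _ (_ : j != i)) 1?eq_sym//.
by rewrite (dfwithC _ _ _ ij).
Qed.

Lemma acts_on_adj i (A : H i -> H i) B :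
  bounded_linear A -> bounded_linear B -> acts_on A B -> acts_on (adj A) (adj B).
Proof.
move=> bA bB h f; apply: tens_inner_ext => g.
rewrite -(adjEl bB) h -{1}[f](dfwith_id _ i) inner_tens_dfwith.
by rewrite -[g in RHS](dfwith_id _ i) inner_tens_dfwith (adjEl bA).
Qed.

(** Rank one operators in the places of s compose to an operator that forgets
    these coordinates: they only contribute a scalar. *)
Lemma foldl_rank_one (a b : forall i, H i) (O : 'I_n -> T -> T) (s : seq 'I_n) :
  (forall i, acts_on (fun h => '[h, b i] *: a i) (O i)) ->
  (forall i, bounded_linear (O i)) -> uniq s ->
  forall f, foldl (fun u i => O i u) (tens T f) s =
    (\prod_(i <- s) '[f i, b i]) *:
    tens T (fun i => if i \in s then a i else f i).
Proof.
move=> hO bO; elim: s => [_|i s IH /= /andP[ins us]] f.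
  by rewrite /= big_nil scale1r.
have -> : O i (tens T f) = '[f i, b i] *: tens T (dfwith f i (a i)).
  by rewrite hO (blZ (tens_coordinate_bl f i)).
have foldZ c v : foldl (fun u i => O i u) (c *: v) s =
    c *: foldl (fun u i => O i u) v s.
  by elim: s v {IH ins us} => // j s IHs v /=; rewrite blZ.
rewrite foldZ IH// scalerA big_cons; congr (_ * _ *: tens T _).
  apply: eq_big_seq => j js; rewrite dfwithout//.
  by apply: contraNneq ins => ->.
apply: functional_extensionality_dep => j; rewrite in_cons.
have [<-|ij] := eqVneq i j; first by rewrite dfwithin if_same.
by rewrite dfwithout.
Qed.

End Tensors.

(** * Tensor products of closed subspaces *)

Section Compressions.
Variables (R : realType) (V : hilbertType R).
Implicit Types (A : V -> V) (Q S : set V).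

Lemma orth_adj_invariant A S y : bounded_linear A ->
  (forall x, S x -> S (A x)) -> orth S y -> orth S (adj A y).
Proof. by move=> bA AS hy s Ss; rewrite -adjEl// hy//; exact: AS. Qed.

(** For a subspace invariant under the adjoint of A, the adjoint of the compression
    of A is a restriction, which involves no projection. *)
Lemma adjoint_on_compression A Q y : closed_subspace Q -> bounded_linear A ->
  Q (adj A y) -> Q y -> adjoint_on Q (compression Q A) y = adj A y.
Proof.
move=> cQ bA Qa Qy.
have h x : Q x -> '[compression Q A x, y] = '[x, adj A y].
  by move=> Qx; rewrite /compression proj_inner// adjE.
have [Qz hz] := xgetPex 0 (ex_intro
  [set z | Q z /\ forall x, Q x -> '[compression Q A x, y] = '[x, z]]
  (adj A y) (conj Qa h)).
rewrite /adjoint_on; set z := xget _ _ in Qz hz *.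
apply/eqP; rewrite -subr_eq0; apply/eqP/inner_eq0.
have Qd : Q (z - adj A y) by exact: closed_subspaceB.
by rewrite innerBr -hz// h// subrr.
Qed.

End Compressions.

Section TensorSubspaces.
Variables (R : realType) (n : nat) (H : 'I_n -> hilbert_module R).
Variable (T : tensor_module H).
Implicit Types (f g : forall i, H i) (i j : 'I_n) (Q : forall i, set (H i)).

Lemma tensor_sub_closed Q : closed_subspace (tensor_sub T Q).
Proof. exact: closed_span_closed. Qed.

Lemma tensor_sub_tens Q f : (forall i, Q i (f i)) -> tensor_sub T Q (tens T f).
Proof. by move=> Qf; apply: sub_closed_span; exists f. Qed.

Lemma tensor_sub_min Q (X : set T) : closed_subspace X ->
  (forall f, (forall i, Q i (f i)) -> X (tens T f)) -> tensor_sub T Q `<=` X.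
Proof. by move=> cX h; apply: closed_span_min => // _ [f Qf <-]; exact: h. Qed.

Lemma orth_tensor_sub Q u : orth (tensor_sub T Q) u <->
  forall f, (forall i, Q i (f i)) -> '[u, tens T f] = 0.
Proof.
rewrite /tensor_sub orth_closed_span; split=> [h f Qf|h _ [f Qf <-]].
  by apply: h; exists f.
exact: h.
Qed.

Lemma dfwith_setP i (E : set (H i)) f :
  (forall j, dfwith (fun j => [set: H j]) i E j (f j)) <-> E (f i).
Proof.
split=> [/(_ i)|Ef j]; first by rewrite dfwithin.
by have [<-|ij] := eqVneq i j; rewrite ?dfwithin// dfwithout.
Qed.

Lemma tensor_sub1_closed i (E : set (H i)) : closed_subspace (tensor_sub1 T i E).
Proof. exact: tensor_sub_closed. Qed.

Lemma tensor_sub1_tens i (E : set (H i)) f :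
  E (f i) -> tensor_sub1 T i E (tens T f).
Proof. by move=> Ef; apply/tensor_sub_tens/(dfwith_setP E f). Qed.

Lemma tensor_sub1_min i (E : set (H i)) (X : set T) : closed_subspace X ->
  (forall f, E (f i) -> X (tens T f)) -> tensor_sub1 T i E `<=` X.
Proof. by move=> cX h; apply: tensor_sub_min => // f /(dfwith_setP E f); exact: h. Qed.

Lemma proj_tensor_sub Q f :
  (forall i, closed_subspace (Q i)) ->
  proj (tensor_sub T Q) (tens T f) = tens T (fun i => proj (Q i) (f i)).
Proof.
move=> cQ; apply: proj_unique; first exact: tensor_sub_closed.
  by apply: tensor_sub_tens => i; exact: proj_in.
apply/orth_tensor_sub => g Qg; rewrite innerBl !inner_tens.
apply/eqP; rewrite subr_eq0; apply/eqP; apply: eq_bigr => i _.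
by rewrite proj_inner.
Qed.

Lemma proj_tensor_sub1 i (E : set (H i)) : closed_subspace E ->
  acts_on (proj E) (proj (tensor_sub1 T i E)).
Proof.
move=> cE f; rewrite /tensor_sub1 proj_tensor_sub.
  congr (tens T _); apply: functional_extensionality_dep => j.
  have [<-|ij] := eqVneq i j; first by rewrite !dfwithin.
  rewrite !dfwithout// proj_id//; exact: closed_subspaceT.
move=> j; have [<-|ij] := eqVneq i j; first by rewrite dfwithin.
by rewrite dfwithout//; exact: closed_subspaceT.
Qed.

(** On the product with the other factors, I - P_E (x) I = P_{E^perp} (x) I. *)
Lemma sub_proj_tensor_sub1 i (E : set (H i)) u : closed_subspace E ->
  tensor_sub1 T i (orth E) (u - proj (tensor_sub1 T i E) u).
Proof.
move=> cE.
have bp := bl_sub (bl_id _) (proj_bl (tensor_sub1_closed E)).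
apply: (tens_spans (bl_preimage_closed bp (tensor_sub1_closed (orth E)))) => f /=.
rewrite proj_tensor_sub1// -{1}[f](dfwith_id _ i).
rewrite -(blB (tens_coordinate_bl T f i)).
by apply: tensor_sub1_tens; rewrite dfwithin; exact: proj_orth.
Qed.

Definition factor_proj Q i := proj (tensor_sub1 T i (Q i)).

(** The commuting projections onto H_1 (x) ... (x) Q_i (x) ... (x) H_n compose to the
    projection onto the tensor product of all Q_i. *)
Lemma foldl_proj_tens Q (s : seq 'I_n) f :
  (forall i, closed_subspace (Q i)) ->
  foldl (fun u i => factor_proj Q i u) (tens T f) s =
  tens T (fun i => if i \in s then proj (Q i) (f i) else f i).
Proof.
move=> cQ; elim: s f => [|i s IH] f //=.
rewrite /factor_proj proj_tensor_sub1// IH; congr (tens T _).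
apply: functional_extensionality_dep => j; rewrite in_cons.
have [<-|ij] := eqVneq i j; last by rewrite dfwithout.
rewrite dfwithin /=; case: ifP => // _; rewrite proj_id//.
exact: proj_in.
Qed.

Lemma foldl_proj_bl Q (s : seq 'I_n) :
  bounded_linear (fun u => foldl (fun u i => factor_proj Q i u) u s).
Proof.
elim: s => [|i s IH]; first exact: bl_id.
by have := bl_comp IH (proj_bl (tensor_sub1_closed (Q i))).
Qed.

Lemma proj_tensor_subE Q u :
  (forall i, closed_subspace (Q i)) ->
  proj (tensor_sub T Q) u = foldl (fun u i => factor_proj Q i u) u (enum 'I_n).
Proof.
move=> cQ.
apply: (tens_map_ext (proj_bl (tensor_sub_closed Q)) (foldl_proj_bl Q _)) => f.
rewrite proj_tensor_sub// foldl_proj_tens//; congr (tens T _).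
by apply: functional_extensionality_dep => i; rewrite mem_enum.
Qed.

Lemma tensor_sub_cap Q u :
  (forall i, closed_subspace (Q i)) ->
  (forall i, tensor_sub1 T i (Q i) u) -> tensor_sub T Q u.
Proof.
move=> cQ hu.
have fu i : factor_proj Q i u = u.
  by apply: proj_id => //; exact: tensor_sub1_closed.
have -> : u = proj (tensor_sub T Q) u.
  by rewrite proj_tensor_subE//; elim: (enum _) => //= i s; rewrite fu.
by apply: proj_in; exact: tensor_sub_closed.
Qed.

(** With P_i the projections of the factors, u = u - P_n ... P_1 u telescopes into
    terms v - P_i v, each of them in the i-th summand. *)
Lemma orth_tensor_sub_sum Q :
  (forall i, closed_subspace (Q i)) ->
  orth (tensor_sub T Q) = sum_sub (fun i => tensor_sub1 T i (orth (Q i))).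
Proof.
move=> cQ; apply/seteqP; split=> u.
  move=> hu.
  have : u - proj (tensor_sub T Q) u = u.
    by rewrite proj_eq0 ?subr0//; exact: tensor_sub_closed.
  rewrite proj_tensor_subE// => <-.
  elim: (enum _) u {hu} => [|i s IH] u /=.
    exists (fun=> 0); last by rewrite subrr big1.
    by move=> i; case: (tensor_sub1_closed (orth (Q i))).
  have [y hy E] := IH (factor_proj Q i u).
  exists (fun j => (if j == i then u - factor_proj Q i u else 0) + y j).
    move=> j; apply: (@closed_subspaceD _ _ (tensor_sub1 T j (orth (Q j)))) => //.
      exact: tensor_sub1_closed.
    case: eqVneq => [->|_]; first exact: sub_proj_tensor_sub1.
    by case: (tensor_sub1_closed (orth (Q j))).
  by rewrite big_split -E /= -big_mkcond big_pred1_eq addrA subrK.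
move=> [y hy ->].
apply: (@closed_subspace_sum _ _ (orth (tensor_sub T Q))); first exact: orth_closed.
move=> i _; have := hy i; apply: tensor_sub1_min; first exact: orth_closed.
move=> f fi; apply/orth_tensor_sub => g Qg.
by rewrite inner_tens (bigD1 i)//= fi// mul0r.
Qed.

Lemma tMz_bl i : bounded_linear (tMz T i).
Proof. exact: (bounded_linearP (@tMz_bounded _ _ _ T i)). Qed.

Lemma tMz_acts_on i : acts_on (Mz (H i)) (tMz T i).
Proof. by move=> f; exact: tMzE. Qed.

Lemma tMzs_bl i : bounded_linear (adj (tMz T i)).
Proof. exact/adj_bl/tMz_bl. Qed.

Lemma tMzs_acts_on i : acts_on (adj (Mz (H i))) (adj (tMz T i)).
Proof. apply: acts_on_adj (tMz_acts_on i); [exact: Mz_bl|exact: tMz_bl]. Qed.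

Lemma quotient_module_adj i (E : set (H i)) x :
  quotient_module1 E -> E x -> E (adj (Mz (H i)) x).
Proof.
move=> [cE [_ ME]] Ex; rewrite -(orth_orth cE).
apply: orth_adj_invariant; [exact: Mz_bl|by move=> y; exact: (ME tt)|].
by rewrite orth_orth.
Qed.

(** Projection onto the tensor product, multiplication in place i and adjoint
    multiplication in place j all act factor by factor. In place j only the
    projection acts besides, and it does nothing on the invariant Q_j. *)
Lemma tensor_sub_doubly_commuting Q : (forall i, quotient_module1 (Q i)) ->
  doubly_commuting (tMz T) (tensor_sub T Q).
Proof.
move=> qQ i j ij x Qx; have cQ k : closed_subspace (Q k) by case: (qQ k).
have cT := tensor_sub_closed Q.
have ne : i != j by rewrite neq_ltn ij.
have MQ y : tensor_sub T Q y -> tensor_sub T Q (adj (tMz T j) y).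
  apply: (@tensor_sub_min Q [set y | tensor_sub T Q (adj (tMz T j) y)]).
    exact: (bl_preimage_closed (tMzs_bl j) cT).
  move=> f Qf /=; rewrite tMzs_acts_on; apply: tensor_sub_tens => k.
  have [<-|jk] := eqVneq j k; last by rewrite dfwithout.
  by rewrite dfwithin; exact: quotient_module_adj.
have aE y : tensor_sub T Q y -> adjoint_on (tensor_sub T Q)
    (compression (tensor_sub T Q) (tMz T j)) y = adj (tMz T j) y.
  move=> Qy; apply: (adjoint_on_compression cT) => //; first exact: tMz_bl.
  exact: MQ.
rewrite /= !aE//; last by apply: proj_in.
pose A u := proj (tensor_sub T Q) (tMz T i (adj (tMz T j) u)).
pose B u := adj (tMz T j) (proj (tensor_sub T Q) (tMz T i u)).
have bP := proj_bl cT.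
have bA : bounded_linear A := bl_comp bP (bl_comp (tMz_bl i) (tMzs_bl j)).
have bB : bounded_linear B := bl_comp (tMzs_bl j) (bl_comp bP (tMz_bl i)).
suff : A x - B x = 0 by move/eqP; rewrite subr_eq0 => /eqP.
have := bl_kernel_closed (bl_sub bA bB).
move/tensor_sub_min => /(_ Q); apply => // f Qf /=.
rewrite /A /B tMzs_acts_on !tMz_acts_on !proj_tensor_sub// tMzs_acts_on.
apply/eqP; rewrite subr_eq0; apply/eqP; congr (tens T _).
apply: functional_extensionality_dep => k.
have [<-|jk] := eqVneq j k.
  rewrite dfwithin dfwithout// dfwithin dfwithout// !proj_id//.
  exact: quotient_module_adj.
rewrite [RHS]dfwithout//; have [<-|ik] := eqVneq i k.
  by rewrite !dfwithin dfwithout// eq_sym.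
by rewrite !dfwithout.
Qed.

End TensorSubspaces.

(** * The factors of a subspace of a tensor product *)

Section HereditaryInvariance.
Variables (R : realType) (V : hilbertType R) (A : V -> V).
Hypothesis bA : bounded_linear A.
Let B := adj A.
Implicit Types (D Q X : set V) (p : {poly {poly R[i]}}).

Lemma iter_invariant Q (C : V -> V) k u :
  (forall v, Q v -> Q (C v)) -> Q u -> Q (iter k C u).
Proof. by move=> h Qu; elim: k => //= k; exact: h. Qed.

Lemma inner_iter_adj k u v : '[u, iter k A v] = '[iter k B u, v].
Proof. by elim: k u v => // k IH u v; rewrite iterS iterSr adjEl// IH. Qed.

(** If the polynomial gives the rank one operator u |-> <u, y> x, then this is
    u |-> <u, A^m y> A^l x. *)
Definition hereditary_shift p l m u : V := iter l A (hereditary A B p (iter m B u)).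

Lemma hereditary_shift_bl p l m : bounded_linear (hereditary_shift p l m).
Proof.
have bB : bounded_linear B by exact: adj_bl.
exact: bl_comp (bl_iter l bA) (bl_comp (hereditary_bl p bA bB) (bl_iter m bB)).
Qed.

Lemma hereditary_shift_in X Q p l m q : closed_subspace X ->
  (forall u, Q u -> Q (B u)) -> (forall k u, Q u -> X (iter k A u)) ->
  Q q -> X (hereditary_shift p l m q).
Proof.
move=> cX QB XA Qq; rewrite /hereditary_shift /hereditary.
rewrite (bl_sum (bl_iter l bA)); apply: closed_subspace_sum => // k _.
rewrite /peval (bl_sum (bl_iter l bA)); apply: closed_subspace_sum => // j _.
rewrite (blZ (bl_iter l bA)) -iterD; apply: closed_subspaceZ => //.
by apply: XA; do 2 apply: iter_invariant => //.
Qed.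

End HereditaryInvariance.

Section Factors.
Variables (R : realType) (n : nat) (H : 'I_n -> hilbert_module R).
Variable (T : tensor_module H).
Implicit Types (f g : forall i, H i) (i j : 'I_n) (Q D X : set T) (u q : T).

Local Notation M i := (tMz T i).
Local Notation Ms i := (adj (tMz T i)).

(** Contraction of u against f in all places but i. *)
Definition slice f i u : H i := adj (fun h => tens T (dfwith f i h)) u.

Lemma sliceE f i u h : '[tens T (dfwith f i h), u] = '[h, slice f i u].
Proof. exact/adjE/tens_coordinate_bl. Qed.

Lemma slice_bl f i : bounded_linear (slice f i).
Proof. exact/adj_bl/tens_coordinate_bl. Qed.

Lemma slice_tens f g i :
  slice f i (tens T g) = (\prod_(j | j != i) '[g j, f j]) *: g i.
Proof.
apply: inner_ext => h; rewrite innerC -sliceE -innerC -{1}[g](dfwith_id _ i).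
by rewrite inner_tens_dfwith innerZl mulrC.
Qed.

(** The smallest closed subspace E with Q inside H_1 (x) ... (x) E (x) ... (x) H_n. *)
Definition tensor_factor Q i : set (H i) :=
  closed_span [set v | exists f q, Q q /\ v = slice f i q].

Arguments tensor_factor Q i : clear implicits.

Lemma factor_slice Q i f q : Q q -> tensor_factor Q i (slice f i q).
Proof. by move=> Qq; apply: sub_closed_span; exists f, q. Qed.

Lemma factor_closed Q i : closed_subspace (tensor_factor Q i).
Proof. exact: closed_span_closed. Qed.

(** Slicing intertwines the adjoints of multiplication on the tensor product and
    on the i-th factor. *)
Lemma factor_quotient Q i :
  (forall q, Q q -> Q (Ms i q)) -> quotient_module1 (tensor_factor Q i).
Proof.
move=> QM; split; first exact: factor_closed.
rewrite /tensor_factor orth_closed_span; split; first exact: orth_closed.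
move=> _ h hh _ [f [q [Qq ->]]].
have := tMz_acts_on T i (dfwith f i h); rewrite dfwithin dfwithK => E.
rewrite -sliceE -E (adjE (tMz_bl T i)) sliceE; apply: hh.
by exists f, (Ms i q); split=> //; exact: QM.
Qed.

Lemma sub_tensor_sub_factor Q i : Q `<=` tensor_sub1 T i (tensor_factor Q i).
Proof.
move=> q Qq; set X := tensor_sub1 T i _.
have cX : closed_subspace X by exact: tensor_sub1_closed.
have := @sub_proj_tensor_sub1 _ _ _ T i _ q (factor_closed Q i).
rewrite -/X; set d := q - _ => dE.
have qd : '[q, d] = 0.
  suff : orth [set q] d by move=> h; exact/inner_eq0C/h.
  apply: tensor_sub1_min dE; first exact: orth_closed.
  move=> f fi _ ->; rewrite -[f](dfwith_id _ i) sliceE fi//.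
  exact: factor_slice.
have : d = 0.
  apply: inner_eq0; rewrite {1}/d innerBl qd sub0r (inner_eq0C (x := d)) ?oppr0//.
  by apply: proj_orth => //; exact: proj_in.
by move/eqP; rewrite subr_eq0 => /eqP ->; exact: proj_in.
Qed.

Lemma tens_orbit_span i (h : H i) (z : forall j, H j) X :
  (forall j, total_set (orbit_set (Mz (H j)) (z j))) -> closed_subspace X ->
  (forall m : 'I_n -> nat,
    X (tens T (dfwith (fun j => iter (m j) (Mz (H j)) (z j)) i h))) ->
  forall f, X (tens T (dfwith f i h)).
Proof.
move=> tz cX hX f.
pose A := dfwith (fun j => orbit_set (Mz (H j)) (z j)) i [set h].
apply: (tens_closed_span (A := A) cX) => [g Ag|j].
  have [m hm] : exists m : 'I_n -> nat,
      forall j, j != i -> iter (m j) (Mz (H j)) (z j) = g j.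
    have /choice[m hm] : forall j, exists k,
        j != i -> iter k (Mz (H j)) (z j) = g j.
      move=> j; have [->|ji] := eqVneq j i; first by exists 0.
      have := Ag j; rewrite /A dfwithout 1?eq_sym// => -[k _ kE].
      by exists k.
    by exists m.
  have -> : g = dfwith (fun j => iter (m j) (Mz (H j)) (z j)) i h.
    apply: functional_extensionality_dep => j.
    have [<-|ij] := eqVneq i j.
      by have := Ag i; rewrite /A !dfwithin.
    by rewrite dfwithout// hm// eq_sym.
  exact: hX.
have [<-|ij] := eqVneq i j.
  by rewrite /A !dfwithin; exact: sub_closed_span.
rewrite /A dfwithout//; apply: closed_subspace_eqT; first exact: closed_span_closed.
by move=> a; rewrite orth_closed_span; exact: tz.
Qed.

End Factors.
Arguments tensor_factor {R n H T} Q i _.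

(** * Doubly commuting quotient modules *)

Section DoublyCommuting.
Variables (R : realType) (n : nat) (H : 'I_n -> hilbert_module R).
Variable (T : tensor_module H).
Implicit Types (f g : forall i, H i) (i j : 'I_n) (Q D X : set T) (u q : T).

Local Notation M i := (tMz T i).
Local Notation Ms i := (adj (tMz T i)).

Lemma hereditary_shift_acts_on i p l m :
  acts_on (hereditary_shift (Mz (H i)) p l m) (hereditary_shift (M i) p l m).
Proof.
have h := acts_on_comp (acts_on_hereditary p (tMz_acts_on T i) (tMzs_acts_on T i))
  (acts_on_iter m (tMzs_acts_on T i)).
exact: acts_on_comp (acts_on_iter l (tMz_acts_on T i)) h.
Qed.

Lemma hereditary_shift_rank_one i p (x y : H i) l m :
  (forall h, hereditary (Mz (H i)) (adj (Mz (H i))) p h = '[h, y] *: x) ->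
  acts_on (fun h => '[h, iter m (Mz (H i)) y] *: iter l (Mz (H i)) x)
          (hereditary_shift (M i) p l m).
Proof.
move=> hp f; rewrite hereditary_shift_acts_on /hereditary_shift hp.
by rewrite (blZ (bl_iter l (Mz_bl _))) (inner_iter_adj (Mz_bl _)).
Qed.

Lemma Ms_commute_shift i j p l m u : i != j ->
  Ms j (hereditary_shift (M i) p l m u) = hereditary_shift (M i) p l m (Ms j u).
Proof.
move=> ij; apply: (acts_on_commute (i := j) (j := i)).
- by rewrite eq_sym.
- exact: tMzs_bl.
- exact/hereditary_shift_bl/tMz_bl.
- exact: tMzs_acts_on.
- exact: hereditary_shift_acts_on.
Qed.

(** If D and Q are orthogonal and both invariant under the adjoint of M_j, then
    moving the powers of M_j to the side of D shows that D is orthogonal to any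
    hereditary polynomial in M_j applied to Q. These vectors are again invariant
    under the adjoints of the other multiplications, so the places can be treated
    in turn. *)
Lemma orth_shifts D Q (p : 'I_n -> {poly {poly R[i]}}) (l m : 'I_n -> nat)
    (s : seq 'I_n) : uniq s ->
  (forall j d, j \in s -> D d -> D (Ms j d)) ->
  (forall j q, j \in s -> Q q -> Q (Ms j q)) ->
  (forall d q, D d -> Q q -> '[d, q] = 0) ->
  forall d q, D d -> Q q ->
    '[d, foldl (fun u j => hereditary_shift (M j) (p j) (l j) (m j) u) q s] = 0.
Proof.
move=> us hD; elim: s Q us hD => [|j s IH] Q /= us hD hQ DQ d q Dd Qq.
  exact: DQ.
move: us => /andP[js us].
apply: (IH [set hereditary_shift (M j) (p j) (l j) (m j) q | q in Q]) => //.
- by move=> k d' ks; apply: hD; rewrite in_cons ks orbT.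
- move=> k _ ks [q' Qq' <-]; rewrite Ms_commute_shift; last first.
    by apply: contraNneq js => ->.
  by exists (Ms k q') => //; apply: hQ => //; rewrite in_cons ks orbT.
- move=> d' _ Dd' [q' Qq' <-]; apply: inner_eq0C.
  have : orth [set d'] (hereditary_shift (M j) (p j) (l j) (m j) q').
    apply: (hereditary_shift_in (tMz_bl T j) (Q := Q)) => //.
    + exact: orth_closed.
    + by move=> u; apply: hQ; rewrite mem_head.
    + move=> k u Qu _ ->; apply: inner_eq0C.
      rewrite (inner_iter_adj (tMz_bl T j)); apply: DQ => //.
      by apply: iter_invariant => // v; apply: hD; rewrite mem_head.
  exact.
- by exists q.
Qed.

Section Quotient.
Variable Q : set T.
Hypothesis cQ : closed_subspace Q.
Hypothesis QMs : forall i q, Q q -> Q (Ms i q).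
Hypothesis dcQ : doubly_commuting (tMz T) Q.

(** Double commutativity is only given for i < j; taking adjoints on Q exchanges
    i and j. *)
Lemma doubly_commuting_proj i j q : i != j -> Q q ->
  proj Q (M i (Ms j q)) = Ms j (proj Q (M i q)).
Proof.
have aE k y : Q y -> adjoint_on Q (compression Q (M k)) y = Ms k y.
  by move=> Qy; apply: (adjoint_on_compression cQ) => //;
    [exact: tMz_bl|exact: QMs].
have lt_case (a b : 'I_n) y : (a < b)%N -> Q y ->
    proj Q (M a (Ms b y)) = Ms b (proj Q (M a y)).
  move=> ab Qy; have := dcQ ab Qy; rewrite /= !aE//.
  by apply: proj_in.
move=> ne Qq; have [ij|ji|/val_inj ij] := ltngtP i j; first exact: lt_case.
  have Q1 : Q (proj Q (M i (Ms j q))) by exact: proj_in.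
  have Q2 : Q (Ms j (proj Q (M i q))) by apply: QMs; exact: proj_in.
  have projr u v : Q u -> '[u, proj Q v] = '[u, v].
    by move=> Qu; rewrite innerC proj_inner// -innerC.
  have E d : Q d -> '[proj Q (M i (Ms j q)), d] = '[Ms j (proj Q (M i q)), d].
    move=> Qd; rewrite proj_inner// (adjE (tMz_bl T i)) -(adjEl (tMz_bl T j)).
    rewrite -projr// lt_case// -(adjE (tMz_bl T i)) -(adjEl (tMz_bl T j)).
    rewrite -(proj_inner (M i q) cQ (proj_in (M j d) cQ)) projr//.
    exact: proj_in.
  apply/eqP; rewrite -subr_eq0; apply/eqP/inner_eq0.
  by rewrite innerBl E ?subrr//; exact: closed_subspaceB.
by rewrite ij eqxx in ne.
Qed.

Variable p : 'I_n -> {poly {poly R[i]}}.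

Definition rank_one_system (x y : forall i, H i) := forall i,
  [/\ forall h, hereditary (Mz (H i)) (adj (Mz (H i))) (p i) h = '[h, y i] *: x i,
      total_set (orbit_set (Mz (H i)) (x i)) &
      total_set (orbit_set (Mz (H i)) (y i))].

(** Both sides are bounded and linear in u; on elementary tensors the scalars that
    the places j <> i contribute are those of the slice. *)
Lemma shifts_except_slice (x y : forall i, H i) (l m : 'I_n -> nat) i u :
  rank_one_system x y ->
  foldl (fun u j => hereditary_shift (M j) (p j) (l j) (m j) u) u
    [seq j <- enum 'I_n | j != i] =
  tens T (dfwith (fun j => iter (l j) (Mz (H j)) (x j)) i
    (slice (fun j => iter (m j) (Mz (H j)) (y j)) i u)).
Proof.
move=> hxy.
pose a j := iter (l j) (Mz (H j)) (x j); pose b j := iter (m j) (Mz (H j)) (y j).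
rewrite -/a -/b.
set s := [seq j <- enum 'I_n | j != i].
have bO j : bounded_linear (hereditary_shift (M j) (p j) (l j) (m j)).
  exact/hereditary_shift_bl/tMz_bl.
have bs : bounded_linear (fun u =>
    foldl (fun u j => hereditary_shift (M j) (p j) (l j) (m j) u) u s).
  elim: s => [|j s IH]; first exact: bl_id.
  by have := bl_comp IH (bO j).
apply: (tens_map_ext bs (bl_comp (tens_coordinate_bl T a i) (slice_bl T b i))).
move=> f /=; rewrite (@foldl_rank_one _ _ _ _ a b)//; first last.
- by rewrite filter_uniq// enum_uniq.
- by move=> j; have [hp _ _] := hxy j; exact: hereditary_shift_rank_one.
rewrite slice_tens (blZ (tens_coordinate_bl T a i)); congr (_ *: tens T _).
  by rewrite big_filter big_enum_cond.
apply: functional_extensionality_dep => j.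
rewrite mem_filter mem_enum andbT.
by have [->|ji] := eqVneq j i; rewrite ?dfwithin// dfwithout// eq_sym.
Qed.

(** By double commutativity the vectors M_i q - P_Q M_i q form a set D invariant
    under the adjoints of M_j, j <> i, and D is orthogonal to Q. So D is
    orthogonal to the images of Q under rank one operators in the places j <> i,
    and these images span the space in question. *)
Lemma compression_defect_orth (x y : forall i, H i) i q : rank_one_system x y ->
  Q q -> orth (tensor_sub1 T i (tensor_factor Q i)) (M i q - proj Q (M i q)).
Proof.
move=> hxy Qq.
pose D := [set M i q - proj Q (M i q) | q in Q].
set d := M i q - _; have Dd : D d by exists q.
pose s := [seq j <- enum 'I_n | j != i].
have us : uniq s by rewrite filter_uniq// enum_uniq.
have si j : j \in s -> j != i by rewrite mem_filter => /andP[].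
have hD l m q' : Q q' -> '[d,
    foldl (fun u j => hereditary_shift (M j) (p j) (l j) (m j) u) q' s] = 0.
  apply: (@orth_shifts D Q) => //.
  - move=> j _ /si ji [q1 Qq1 <-]; exists (Ms j q1); first exact: QMs.
    rewrite (blB (tMzs_bl T j)) -doubly_commuting_proj 1?eq_sym//.
    congr (_ - _); have ij : i != j by rewrite eq_sym.
    by apply: (acts_on_commute ij); [exact: tMz_bl|exact: tMzs_bl
      |exact: tMz_acts_on|exact: tMzs_acts_on].
  - by move=> j q1 _; exact: QMs.
  - by move=> _ q1 [q2 Qq2 <-] Qq1; apply: proj_orth.
suff hf f : tensor_factor Q i (f i) -> '[tens T f, d] = 0.
  have : tensor_sub1 T i (tensor_factor Q i) `<=` orth [set d].
    apply: tensor_sub1_min; first exact: orth_closed.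
    by move=> f /hf h _ ->.
  by move=> h u /h hu; apply/inner_eq0C/hu.
rewrite -{2}[f](dfwith_id _ i); move: (f i) => v fv.
have tx j : total_set (orbit_set (Mz (H j)) (x j)) by case: (hxy j).
have ty j : total_set (orbit_set (Mz (H j)) (y j)) by case: (hxy j).
suff : orth [set d] (tens T (dfwith f i v)) by apply.
apply: (tens_orbit_span tx (orth_closed _)) => l.
pose a j := iter (l j) (Mz (H j)) (x j); rewrite -/a.
have cX := bl_preimage_closed (tens_coordinate_bl T a i) (orth_closed [set d]).
set X := [set h | _] in cX.
suff : tensor_factor Q i `<=` X by apply.
rewrite -[X in _ `<=` X](orth_orth cX).
apply: closed_span_min; first exact: orth_closed.
move=> _ [g [q1 [Qq1 ->]]] h hX; rewrite innerC -sliceE.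
suff : orth [set q1] (tens T (dfwith g i h)) by move=> ->//; rewrite conjC0.
apply: (tens_orbit_span ty (orth_closed _)) => m _ ->.
rewrite sliceE; apply: hX; rewrite /X /= => _ ->.
by rewrite -(shifts_except_slice l m i q1 hxy); apply/inner_eq0C/hD.
Qed.

(** The compression of M_i to H_1 (x) ... (x) Q_i (x) ... (x) H_n therefore maps Q to
    Q, with the same values as the compression of M_i to Q. *)
Lemma proj_iter_in (x y : forall i, H i) i k q : rank_one_system x y -> Q q ->
  Q (proj (tensor_sub1 T i (tensor_factor Q i)) (iter k (M i) q)).
Proof.
move=> hxy; elim: k q => [|k IH] q Qq /=.
  rewrite proj_id//; first exact: tensor_sub1_closed.
  exact: sub_tensor_sub_factor.
have cX := @tensor_sub1_closed _ _ _ T i (tensor_factor Q i).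
set X := tensor_sub1 T i _ in cX *.
have bP := proj_bl cX; have bk := bl_iter k (tMz_bl T i).
rewrite -iterS iterSr -[M i q](subrK (proj Q (M i q))) addrC.
rewrite (blD bk) (blD bP); apply: closed_subspaceD => //.
  by apply: IH; exact: proj_in.
rewrite [X in Q X]proj_eq0//; first exact: closed_subspace0.
apply: (@iter_invariant _ _ (orth X)); last exact: (compression_defect_orth hxy).
move=> d hd u Xu; rewrite (adjE (tMz_bl T i)); apply: hd.
have : X `<=` [set u | X (Ms i u)].
  apply: tensor_sub1_min; first exact: (bl_preimage_closed (tMzs_bl T i)).
  move=> f fi /=; rewrite tMzs_acts_on; apply: tensor_sub1_tens.
  by rewrite dfwithin; exact: (quotient_module_adj (factor_quotient (@QMs i))).
by apply.
Qed.

(** The compressed rank one operators in the n places preserve Q, and their product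
    is u |-> <u, b> a for elementary tensors a and b. The b are total, so one of them
    is not orthogonal to Q; with this b fixed, all the a belong to Q, and they
    span the tensor product of the factors. *)
Lemma tensor_sub_factor_sub (x y : forall i, H i) : (0 < n)%N ->
  rank_one_system x y -> tensor_sub T (tensor_factor Q) `<=` Q.
Proof.
move=> n0 hxy; apply: tensor_sub_min => // f Ff.
have tx j : total_set (orbit_set (Mz (H j)) (x j)) by case: (hxy j).
have ty j : total_set (orbit_set (Mz (H j)) (y j)) by case: (hxy j).
have [[q [Qq q0]]|noq] := pselect (exists q, Q q /\ q != 0); last first.
  pose i := Ordinal n0.
  have : tensor_factor Q i `<=` [set 0].
    have := bl_kernel_closed (bl_id (H i)).
    move/closed_span_min; apply => _ [g [q [Qq ->]]] /=.
    suff -> : q = 0 by exact/bl0/slice_bl.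
    by apply/eqP; apply: contraT => q0; exfalso; apply: noq; exists q.
  move=> /(_ _ (Ff i)) fi0.
  have -> : tens T f = 0.
    by apply: inner_eq0; rewrite inner_tens (bigD1 i)//= fi0 inner0l mul0r.
  exact: closed_subspace0.
(* The vectors b are total because the orbits of the y i are. *)
have [m hm] : exists m : 'I_n -> nat,
    '[q, tens T (fun j => iter (m j) (Mz (H j)) (y j))] != 0.
  apply: contrapT => /forallNP hm; move/eqP: q0; apply.
  apply: inner_eq0; apply: inner_eq0C.
  suff : orth [set q] q by apply.
  apply: (tens_spans (orth_closed _)) => g.
  pose A j := orbit_set (Mz (H j)) (y j).
  apply: (tens_closed_span (A := A) (orth_closed _)) => [g' Ag|].
    have /choice[m hgm] : forall j, exists k, iter k (Mz (H j)) (y j) = g' j.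
      by move=> j; have [k _ kE] := Ag j; exists k.
    have -> : g' = fun j => iter (m j) (Mz (H j)) (y j).
      by apply: functional_extensionality_dep => j; rewrite hgm.
    by move=> _ ->; apply: inner_eq0C; have /negP/negPn/eqP := hm m.
  move=> j; apply: closed_subspace_eqT; first exact: closed_span_closed.
  by move=> a; rewrite orth_closed_span; exact: ty.
pose b j := iter (m j) (Mz (H j)) (y j).
pose E i := proj (tensor_sub1 T i (tensor_factor Q i)).
have bE i : bounded_linear (E i) by exact/proj_bl/tensor_sub1_closed.
(* The composed operator takes q to a nonzero multiple of a. *)
have hl (l : 'I_n -> nat) :
    Q (tens T (fun i => proj (tensor_factor Q i) (iter (l i) (Mz (H i)) (x i)))).
  pose O i u := E i (hereditary_shift (M i) (p i) (l i) (m i) u).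
  have bO i : bounded_linear (O i).
    exact: bl_comp (bE i) (hereditary_shift_bl (tMz_bl T i) _ _ _).
  pose a i := proj (tensor_factor Q i) (iter (l i) (Mz (H i)) (x i)).
  have aO i : acts_on (fun h => '[h, b i] *: a i) (O i).
    move=> g; have [hp _ _] := hxy i.
    rewrite /O (hereditary_shift_rank_one _ _ hp) /E proj_tensor_sub1; last first.
      exact: factor_closed.
    by rewrite dfwithin dfwithK (blZ (proj_bl (factor_closed Q i))).
  have bs (s : seq 'I_n) : bounded_linear (fun u => foldl (fun u i => O i u) u s).
    elim: s => [|i s IH]; first exact: bl_id.
    by have := bl_comp IH (bO i).
  have fE u : foldl (fun u i => O i u) u (enum 'I_n) = '[u, tens T b] *: tens T a.
    apply: (tens_map_ext (bs _) (bl_rank_one _ _)) => g.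
    rewrite (foldl_rank_one aO bO (enum_uniq _)) inner_tens big_enum /=.
    congr (_ *: tens T _); apply: functional_extensionality_dep => i.
    by rewrite mem_enum.
  have QO i u : Q u -> Q (O i u).
    move=> Qu; have cX := bl_preimage_closed (bE i) cQ.
    have h k v : Q v -> Q (E i (iter k (M i) v)).
      by move=> Qv; exact: (proj_iter_in _ _ hxy).
    exact: (hereditary_shift_in (tMz_bl T i) (p i) (l i) (m i) cX (@QMs i) h Qu).
  have : Q (foldl (fun u i => O i u) q (enum 'I_n)).
    by elim: (enum _) {fE} q Qq {q0 hm} => //= i s IH v Qv; apply/IH/QO.
  rewrite fE => /(closed_subspaceZ ('[q, tens T b])^-1 cQ).
  by rewrite scalerA mulVf// scale1r.
pose A i := [set proj (tensor_factor Q i) (iter k (Mz (H i)) (x i)) | k in [set: nat]].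
apply: (tens_closed_span (A := A) cQ) => [g Ag|i].
  have /choice[l hgl] : forall j, exists k,
      proj (tensor_factor Q j) (iter k (Mz (H j)) (x j)) = g j.
    by move=> j; have [k _ kE] := Ag j; exists k.
  have -> : g = fun j => proj (tensor_factor Q j) (iter (l j) (Mz (H j)) (x j)).
    by apply: functional_extensionality_dep => j; rewrite hgl.
  exact: hl.
have cF := factor_closed Q i.
rewrite -(proj_id cF (Ff i)).
have cX := bl_preimage_closed (proj_bl cF) (closed_span_closed (A i)).
apply: (closed_subspace_eqT cX) => h hh; apply: tx => _ [k _ <-].
by apply: hh => /=; apply: sub_closed_span; exists k.
Qed.

Lemma doubly_commuting_factorization (x y : forall i, H i) : (0 < n)%N ->
  rank_one_system x y -> Q = tensor_sub T (tensor_factor Q).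
Proof.
move=> n0 hxy; apply/seteqP; split; last exact: (tensor_sub_factor_sub n0 hxy).
move=> q Qq; apply: tensor_sub_cap => i; first exact: factor_closed.
exact: sub_tensor_sub_factor.
Qed.

End Quotient.
End DoublyCommuting.

Theorem theorem5p2 (R : realType) (n : nat) (hn : (2 <= n)%N)
  (H : 'I_n -> hilbert_module R) (T : tensor_module H)
  (hT : analytic_module H) (S : set T) (hS : submodule (tMz T) S) :
  co_doubly_commuting (tMz T) S <->
  exists Q : forall i, set (H i),
    [/\ forall i, quotient_module1 (Q i),
        S = orth (tensor_sub T Q) &
        orth (tensor_sub T Q) =
          sum_sub (fun i => tensor_sub1 T i (orth (Q i)))].
Proof.
have [cS SM] := hS.
split=> [dc|[Q [qQ -> _]]]; last first.
  rewrite /co_doubly_commuting orth_orth; last exact: tensor_sub_closed.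
  exact: tensor_sub_doubly_commuting.
have QMs i q : orth S q -> orth S (adj (tMz T i) q).
  by apply: orth_adj_invariant => [|u]; [exact: tMz_bl|exact: SM].
have key i : {t : {poly {poly R[i]}} * H i * H i |
    [/\ forall h, hereditary (Mz (H i)) (adj (Mz (H i))) t.1.1 h = '[h, t.2] *: t.1.2,
      total_set (orbit_set (Mz (H i)) t.1.2) &
      total_set (orbit_set (Mz (H i)) t.2)]}.
  apply: cid; have [st kp] := hT i.
  by have [p [x [y hxy]]] := cyclic_rank_one st kp; exists (p, x, y).
have hxy : rank_one_system (fun i => (projT1 (key i)).1.1)
    (fun i => (projT1 (key i)).1.2) (fun i => (projT1 (key i)).2).
  by move=> i; exact: (projT2 (key i)).
have n0 : (0 < n)%N by exact: ltnW.
have E := doubly_commuting_factorization (orth_closed S) QMs dc n0 hxy.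
exists (tensor_factor (orth S)); split.
- by move=> i; apply: factor_quotient; exact: QMs.
- by rewrite -E orth_orth.
- by apply: orth_tensor_sub_sum => i; exact: factor_closed.
Qed.
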